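(* Let $n \ge 3$ be an integer and let $M$ be a planar integral point set of cardinality $n$ in semi-general position whose characteristic is not of the form $4k+3$ with $k \in \mathbb{N}_0$ (equivalently, since the characteristic is squarefree, it is of the form $4k+1$ or $4k+2$). Then $$\operatorname{diam} M \ge \left( \frac{25\,n}{36} \right)^{5/4}.$$
   Context: $\mathbb{N}_0=\{0,1,2,\dots\}$. A planar integral point set is a set $M\subset\mathbb{R}^2$ of points, not all on one straight line, such that the Euclidean distance between any two points of $M$ is an integer (such a set is finite). It is in semi-general position if no three of its points are collinear. Its diameter is $\operatorname{diam} M=\max_{A,B\in M}|AB|$. Two numbers are commensurable if their ratio is rational. The characteristic $\operatorname{char} M$ of a planar integral point set $M$ is the (uniquely determined) squarefree positive integer $q$ such that the area of every triangle with vertices in $M$ is commensurable with $\sqrt{q}$, i.e. is a rational multiple of $\sqrt q$; a positive integer is squarefree if its only perfect square divisor is $1$. *)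

(* Defs.v *)
From mathcomp Require Import all_boot all_order all_algebra.
From mathcomp Require Import finmap.
From mathcomp Require Import reals exp.

Set Implicit Arguments.
Unset Strict Implicit.
Unset Printing Implicit Defensive.

Import Order.TTheory GRing.Theory Num.Theory.
Local Open Scope ring_scope.

Section PlanarIntegralPointSets.
Variable R : realType.
Implicit Types (A B C : R * R) (M S : {fset R * R}).

(* The library norm on R * R is the sup norm, hence the explicit formula. *)
Definition edist A B : R :=
  Num.sqrt ((A.1 - B.1) ^+ 2 + (A.2 - B.2) ^+ 2).

Definition collinear S : Prop :=
  exists a b c : R, (a != 0 \/ b != 0) /\
    forall A, A \in S -> a * A.1 + b * A.2 = c.

Definition planar_integral_point_set M : Prop :=
  ~ collinear M /\
  forall A B, A \in M -> B \in M -> edist A B \is a Num.int.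

Definition semi_general_position M : Prop :=
  forall A B C, A \in M -> B \in M -> C \in M ->
    A != B -> A != C -> B != C -> ~ collinear [fset A; B; C]%fset.

(* Distances are nonnegative, so the default value 0 does not affect the
   maximum over a nonempty set. *)
Definition diam M : R :=
  \big[Num.max/0]_(A <- M) \big[Num.max/0]_(B <- M) edist A B.

Definition triangle_area A B C : R :=
  `|(B.1 - A.1) * (C.2 - A.2) - (C.1 - A.1) * (B.2 - A.2)| / 2.

Definition commensurable (x y : R) : Prop := exists r : rat, x / y = ratr r.

Definition squarefree (q : nat) : Prop :=
  (0 < q)%N /\ forall d : nat, (d ^ 2 %| q)%N -> d = 1%N.

(* [is_char M q]: the characteristic of M is q.  For a planar integral point
   set M exactly one such q exists. *)
Definition is_char M (q : nat) : Prop :=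
  squarefree q /\
  forall A B C, A \in M -> B \in M -> C \in M -> ~ collinear [fset A; B; C]%fset ->
    commensurable (triangle_area A B C) (Num.sqrt q%:R).

End PlanarIntegralPointSets.

(* Main.v *)
Require Import Defs.
From Stdlib Require Import BinNat Nnat.
From mathcomp Require Import all_boot all_order all_algebra.
From mathcomp Require Import finmap.
From mathcomp Require Import reals exp.
From mathcomp Require Import zify ring lra.

(** A triangle with integer sides and odd perimeter has 16 area^2 = 3 mod 4, so
    outside characteristic 4k+3 all perimeters are even, and the side lengths
    are x+y, x+z, y+z with positive integers x, y, z.  Two bounds then compete.

    Let s <= t be the two smallest distances, attained at AB and CE.  The
    difference | |PA| - |PB| | has the parity of s and is at most s-2, so P lies
    on one of few hyperbolas (or on the bisector, which has at most two points);
    likewise for CE.  Two hyperbolas with different foci share at most four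
    points, since five points no three of which are collinear determine a conic
    and a conic determines its foci.  Hence n <= 4 + (s-1)(t-1).

    On the other hand, a triangle with all sides at least a has all heights at
    least sqrt(2a-1).  Sort the points by abscissa: the disjoint strips spanned
    by consecutive triples have width at least sqrt(2t-1), except possibly one
    of width at least sqrt(2s-1), so diam M is at least about
    (n/2) sqrt(2t-1).  Eliminating t gives the bound for n >= 21; for smaller n
    only s = 2, 3, 4 need further arguments, namely that two points on the
    hyperbolas with foci A, B are never symmetric about the midpoint of AB, and
    that the ratio of the areas of PAB and QAB is rational. *)

Set Implicit Arguments.
Unset Strict Implicit.
Unset Printing Implicit Defensive.

Import Order.TTheory GRing.Theory Num.Theory.
Local Open Scope ring_scope.

(** * Plane geometry over an ordered field *)

Section PlaneGeometry.
Variable R : realFieldType.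
Implicit Types A B C D P : R * R.

Definition sqdist A B : R := (A.1 - B.1) ^+ 2 + (A.2 - B.2) ^+ 2.
Definition cross A B C : R :=
  (B.1 - A.1) * (C.2 - A.2) - (C.1 - A.1) * (B.2 - A.2).

(** As [cross] is twice the signed area, both sides are 16 area^2; the product depends only on a^2,
    b^2, c^2, so no signs are required. *)
Lemma heron A B C (a b c : R) :
  a ^+ 2 = sqdist B C -> b ^+ 2 = sqdist A C -> c ^+ 2 = sqdist A B ->
  4 * cross A B C ^+ 2 =
  (a + b + c) * (b + c - a) * (a + c - b) * (a + b - c).
Proof.
move=> ha hb hc.
have -> : (a + b + c) * (b + c - a) * (a + c - b) * (a + b - c) =
  4 * (a ^+ 2 * b ^+ 2) - (a ^+ 2 + b ^+ 2 - c ^+ 2) ^+ 2 by ring.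
rewrite ha hb hc /sqdist /cross; ring.
Qed.

Lemma sqr_le_norm (x y : R) : `|x| <= y -> x ^+ 2 <= y ^+ 2.
Proof.
move=> h; rewrite -[x ^+ 2]real_normK ?num_real // lerXn2r ?nnegrE //.
exact: le_trans h.
Qed.

Lemma norm_le_sqr (x y : R) : 0 <= y -> x ^+ 2 <= y ^+ 2 -> `|x| <= y.
Proof. by move=> y0; rewrite -[x ^+ 2]real_normK ?num_real // ler_sqr ?nnegrE. Qed.

(** [cross] equals (B.1 - A.1)(C.2 - B.2) - (C.1 - B.1)(B.2 - A.2), with vertical differences at
    most c. For c the longest side, the width is at least the shortest height. *)
Lemma cross_le_width A B C (c : R) :
  A.1 <= B.1 -> B.1 <= C.1 -> 0 <= c ->
  sqdist A B <= c ^+ 2 -> sqdist B C <= c ^+ 2 ->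
  cross A B C ^+ 2 <= (C.1 - A.1) ^+ 2 * c ^+ 2.
Proof.
move=> hAB hBC c0 hab hbc.
have ha : `|A.2 - B.2| <= c.
  by apply: norm_le_sqr => //; apply: le_trans hab; rewrite lerDr sqr_ge0.
have hb : `|B.2 - C.2| <= c.
  by apply: norm_le_sqr => //; apply: le_trans hbc; rewrite lerDr sqr_ge0.
have := ler_norml (A.2 - B.2) c; rewrite ha => /esym/andP[ha1 ha2].
have := ler_norml (B.2 - C.2) c; rewrite hb => /esym/andP[hb1 hb2].
rewrite -exprMn; apply: sqr_le_norm.
rewrite ler_norml /cross; apply/andP; split.
  have : 0 <= (B.1 - A.1) * (c + (C.2 - B.2)) by apply: mulr_ge0; lra.
  have : 0 <= (C.1 - B.1) * (c + (A.2 - B.2)) by apply: mulr_ge0; lra.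
  nra.
have : 0 <= (B.1 - A.1) * (c - (C.2 - B.2)) by apply: mulr_ge0; lra.
have : 0 <= (C.1 - B.1) * (c - (A.2 - B.2)) by apply: mulr_ge0; lra.
nra.
Qed.

(* In the triangle with sides x+y, x+z, y+z the squared height on y+z is
   4(x+y+z)xyz/(y+z)^2. *)
Lemma ravi_height (x y z : R) : 1 <= x -> x <= y -> y <= z ->
  (2 * (x + y) - 1) * (y + z) ^+ 2 <= 4 * (x + y + z) * x * y * z.
Proof.
move=> x1 xy yz.
(* In the increments e, f, g the difference of the two sides has only nonnegative coefficients. *)
have [e [xe e0]] : exists e, x = 1 + e /\ 0 <= e by exists (x - 1); split; lra.
have [f [yf f0]] : exists f, y = x + f /\ 0 <= f by exists (y - x); split; lra.
have [g [zg g0]] : exists g, z = y + g /\ 0 <= g by exists (z - y); split; lra.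
subst z; subst y; subst x; rewrite -subr_ge0.
rewrite [X in 0 <= X](_ : _ = 8 * e + 4 * g + 28 * e ^+ 2 + 24 * e * f + 20 * e * g
    + 8 * f * g + 32 * e ^+ 3 + 56 * e ^+ 2 * f + 32 * e ^+ 2 * g + 24 * e * f ^+ 2
    + 32 * e * f * g + 12 * e ^+ 4 + 32 * e ^+ 3 * f + 16 * e ^+ 3 * g + 28 * e ^+ 2
    * f ^+ 2 + 28 * e ^+ 2 * f * g + 4 * f ^+ 2 * g + 8 * e * f ^+ 3 + 12 * e * f ^+
    2 * g + 1 * g ^+ 2 + 4 * e * g ^+ 2 + 2 * f * g ^+ 2 + 4 * e ^+ 2 * g ^+ 2 + 4 *
    e * f * g ^+ 2); last by ring.
by repeat (apply: addr_ge0); repeat (apply: mulr_ge0); rewrite ?exprn_ge0.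
Qed.

(** * Conics through five points and their foci *)

Record conic := Conic { cxx : R; cxy : R; cyy : R; cx : R; cy : R; cc : R }.
Definition conic_eval (K : conic) P : R :=
  cxx K * P.1 ^+ 2 + cxy K * P.1 * P.2 + cyy K * P.2 ^+ 2
  + cx K * P.1 + cy K * P.2 + cc K.

(** Newton interpolation: in the affine frame P1, P2, P3 a quadratic polynomial is determined by its
    values at (0,0), (1,0), (0,1), (2,0), (1,1), (0,2). *)
Lemma conic_newton (K : conic) P1 P2 P3 (x y : R) :
  conic_eval K (P1.1 + x * (P2.1 - P1.1) + y * (P3.1 - P1.1),
                P1.2 + x * (P2.2 - P1.2) + y * (P3.2 - P1.2)) =
  conic_eval K P1 + x * (conic_eval K P2 - conic_eval K P1)
  + y * (conic_eval K P3 - conic_eval K P1)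
  + x * (x - 1) / 2 * (conic_eval K (2 * P2.1 - P1.1, 2 * P2.2 - P1.2)
                       - 2 * conic_eval K P2 + conic_eval K P1)
  + x * y * (conic_eval K (P2.1 + P3.1 - P1.1, P2.2 + P3.2 - P1.2)
             - conic_eval K P2 - conic_eval K P3 + conic_eval K P1)
  + y * (y - 1) / 2 * (conic_eval K (2 * P3.1 - P1.1, 2 * P3.2 - P1.2)
                       - 2 * conic_eval K P3 + conic_eval K P1).
Proof. by rewrite /conic_eval /=; field. Qed.

(** Two independent equations leave a line of solutions (a, b, c), spanned by the vector product of
    the coefficient rows; Cramer's rule expresses a and b through c. *)
Lemma proportional_solution (u4 v4 w4 u5 v5 w5 a b c u v w : R) :
  u4 * v5 - u5 * v4 != 0 ->
  u4 * a + v4 * b + w4 * c = 0 -> u5 * a + v5 * b + w5 * c = 0 ->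
  u * a + v * b + w * c = c / (u4 * v5 - u5 * v4) *
    (u * (v4 * w5 - v5 * w4) + v * (u5 * w4 - u4 * w5) + w * (u4 * v5 - u5 * v4)).
Proof.
move=> r0 h4 h5.
have ha : a = c * (v4 * w5 - v5 * w4) / (u4 * v5 - u5 * v4).
  rewrite -[LHS](mulfK r0); congr (_ / _); apply/eqP; rewrite -subr_eq0; apply/eqP.
  transitivity (0 * v5 - 0 * v4); last by ring.
  by rewrite -{1}h4 -h5; ring.
have hb : b = c * (u5 * w4 - u4 * w5) / (u4 * v5 - u5 * v4).
  rewrite -[LHS](mulfK r0); congr (_ / _); apply/eqP; rewrite -subr_eq0; apply/eqP.
  transitivity (0 * u4 - 0 * u5); last by ring.
  by rewrite -{1}h5 -h4; ring.
by rewrite ha hb; field.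
Qed.

(* In affine coordinates with P1, P2, P3 at (0,0), (1,0), (0,1), a conic through
   these three points is a combination of x(x-1), xy, y(y-1), and each further
   point imposes one linear condition on the three coefficients. *)
Lemma conic_through_five P1 P2 P3 P4 P5 :
  cross P1 P2 P3 != 0 -> cross P1 P2 P4 != 0 -> cross P1 P2 P5 != 0 ->
  cross P1 P3 P4 != 0 -> cross P1 P3 P5 != 0 -> cross P2 P4 P5 != 0 ->
  exists H : R * R -> R, forall K : conic,
    conic_eval K P1 = 0 -> conic_eval K P2 = 0 -> conic_eval K P3 = 0 ->
    conic_eval K P4 = 0 -> conic_eval K P5 = 0 ->
    exists l : R, forall P, conic_eval K P = l * H P.
Proof.
move=> n123 n124 n125 n134 n135 n245.
pose d := cross P1 P2 P3.
pose X P := - cross P1 P3 P / d.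
pose Y P := cross P1 P2 P / d.
pose Q11 : R * R := (2 * P2.1 - P1.1, 2 * P2.2 - P1.2).
pose Q12 : R * R := (P2.1 + P3.1 - P1.1, P2.2 + P3.2 - P1.2).
pose Q22 : R * R := (2 * P3.1 - P1.1, 2 * P3.2 - P1.2).
have hd : (P2.1 - P1.1) * (P3.2 - P1.2) - (P3.1 - P1.1) * (P2.2 - P1.2) != 0.
  by [].
have expand K : conic_eval K P1 = 0 -> conic_eval K P2 = 0 -> conic_eval K P3 = 0 ->
  forall P, conic_eval K P = X P * (X P - 1) * (conic_eval K Q11 / 2)
   + X P * Y P * conic_eval K Q12 + Y P * (Y P - 1) * (conic_eval K Q22 / 2).
  move=> k1 k2 k3 P.
  have := conic_newton K P1 P2 P3 (X P) (Y P).
  rewrite -/Q11 -/Q12 -/Q22 k1 k2 k3.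
  have -> : (P1.1 + X P * (P2.1 - P1.1) + Y P * (P3.1 - P1.1),
             P1.2 + X P * (P2.2 - P1.2) + Y P * (P3.2 - P1.2)) = P.
    case: P => p1 p2 /=; rewrite /X /Y /d /cross /=.
    by congr pair; field.
  by move=> ->; ring.
have X4 : X P4 != 0 by rewrite mulf_neq0 ?invr_eq0 ?oppr_eq0.
have X5 : X P5 != 0 by rewrite mulf_neq0 ?invr_eq0 ?oppr_eq0.
(* (r1, r2, r3) is the vector product of the rows imposed by P4 and P5. *)
pose r1 := X P4 * Y P4 * (Y P5 * (Y P5 - 1)) - X P5 * Y P5 * (Y P4 * (Y P4 - 1)).
pose r2 := X P5 * (X P5 - 1) * (Y P4 * (Y P4 - 1))
         - X P4 * (X P4 - 1) * (Y P5 * (Y P5 - 1)).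
pose r3 := X P4 * (X P4 - 1) * (X P5 * Y P5) - X P5 * (X P5 - 1) * (X P4 * Y P4).
have r3N0 : r3 != 0.
  have -> : r3 = X P4 * X P5 * (cross P2 P4 P5 / d).
    rewrite /r3.
    have -> : cross P2 P4 P5 / d = (X P4 - 1) * Y P5 - (X P5 - 1) * Y P4.
      by rewrite /X /Y /d /cross; field.
    by ring.
  by apply: mulf_neq0; [exact: mulf_neq0 | rewrite mulf_neq0 ?invr_eq0].
exists (fun P => X P * (X P - 1) * r1 + X P * Y P * r2 + Y P * (Y P - 1) * r3).
move=> K k1 k2 k3 k4 k5.
exists (conic_eval K Q22 / 2 / r3) => P; rewrite (expand K k1 k2 k3).
apply: proportional_solution => //; by rewrite -(expand K k1 k2 k3).
Qed.

(* With v = 2 P - A - B and u = B - A, the hyperbola |PA| - |PB| = +- k is the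
   zero set of (v.u)^2 - k^2 |v|^2 - k^2 (|u|^2 - k^2). *)
Definition focal_form A B (k : R) P : R :=
  (sqdist P A - sqdist P B) ^+ 2
  - k ^+ 2 * (2 * sqdist P A + 2 * sqdist P B - sqdist A B)
  - k ^+ 2 * (sqdist A B - k ^+ 2).

(** The term |AB|^2 cancels, and the form splits into the hyperbola factor (a-b)^2 - k^2 and the
    ellipse factor (a+b)^2 - k^2. *)
Lemma focal_form_eq0 A B (k : R) P (a b : R) :
  a ^+ 2 = sqdist P A -> b ^+ 2 = sqdist P B -> (a - b) ^+ 2 = k ^+ 2 ->
  focal_form A B k P = 0.
Proof.
move=> ha hb hk; rewrite /focal_form -ha -hb.
transitivity (((a - b) ^+ 2 - k ^+ 2) * ((a + b) ^+ 2 - k ^+ 2) ); first by ring.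
by rewrite hk subrr mul0r.
Qed.

Lemma focal_form_conic A B (k : R) : exists K, forall P, conic_eval K P = focal_form A B k P.
Proof.
pose u1 := B.1 - A.1; pose u2 := B.2 - A.2.
pose s1 := A.1 + B.1; pose s2 := A.2 + B.2.
exists (Conic (4 * (u1 ^+ 2 - k ^+ 2)) (8 * u1 * u2) (4 * (u2 ^+ 2 - k ^+ 2))
  (4 * k ^+ 2 * s1 - 4 * (u1 * s1 + u2 * s2) * u1)
  (4 * k ^+ 2 * s2 - 4 * (u1 * s1 + u2 * s2) * u2)
  ((u1 * s1 + u2 * s2) ^+ 2 - k ^+ 2 * (s1 ^+ 2 + s2 ^+ 2)
   - k ^+ 2 * (sqdist A B - k ^+ 2))) => P.
by rewrite /focal_form /conic_eval /sqdist /= /u1 /u2 /s1 /s2; ring.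
Qed.

(** Linear terms show that the midpoints agree. Constant terms and determinants of the quadratic
    parts give e2 = l e1 and e2 = l^2 e1, so l = 1; then i^2 = j^2 and v = u or v = -u. *)
Lemma focal_form_proportional A B C D (i j l : R) :
  0 < i -> i ^+ 2 < sqdist A B -> 0 < j -> j ^+ 2 < sqdist C D -> l != 0 ->
  (forall P, focal_form C D j P = l * focal_form A B i P) ->
  (A = C /\ B = D) \/ (A = D /\ B = C).
Proof.
move=> i0 iAB j0 jCD l0 hl.
pose u1 := B.1 - A.1; pose u2 := B.2 - A.2.
pose v1 := D.1 - C.1; pose v2 := D.2 - C.2.
pose w1 := A.1 + B.1 - C.1 - D.1; pose w2 := A.2 + B.2 - C.2 - D.2.
pose e1 := i ^+ 2 * (u1 ^+ 2 + u2 ^+ 2 - i ^+ 2).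
pose e2 := j ^+ 2 * (v1 ^+ 2 + v2 ^+ 2 - j ^+ 2).
(* (x, y) stands for 2P - A - B: the origin is the centre of the first hyperbola, so the right side
   has no linear terms. *)
have main x y : ((x + w1) * v1 + (y + w2) * v2) ^+ 2
    - j ^+ 2 * ((x + w1) ^+ 2 + (y + w2) ^+ 2) - e2
  = l * ((x * u1 + y * u2) ^+ 2 - i ^+ 2 * (x ^+ 2 + y ^+ 2) - e1).
  have := hl ((A.1 + B.1 + x) / 2, (A.2 + B.2 + y) / 2).
  have -> : focal_form C D j ((A.1 + B.1 + x) / 2, (A.2 + B.2 + y) / 2) =
    ((x + w1) * v1 + (y + w2) * v2) ^+ 2
    - j ^+ 2 * ((x + w1) ^+ 2 + (y + w2) ^+ 2) - e2.
    by rewrite /focal_form /sqdist /e2 /w1 /w2 /v1 /v2 /=; field.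
  move=> ->; congr (_ * _).
  by rewrite /focal_form /sqdist /e1 /u1 /u2 /=; field.
have hs : i ^+ 2 < u1 ^+ 2 + u2 ^+ 2.
  by apply: lt_le_trans iAB _; rewrite /sqdist /u1 /u2; lra.
have ht : j ^+ 2 < v1 ^+ 2 + v2 ^+ 2.
  by apply: lt_le_trans jCD _; rewrite /sqdist /v1 /v2; lra.
have i2 : 0 < i ^+ 2 by rewrite exprn_gt0.
have j2 : 0 < j ^+ 2 by rewrite exprn_gt0.
have e1P : 0 < e1 by rewrite mulr_gt0 // subr_gt0.
have e2P : 0 < e2 by rewrite mulr_gt0 // subr_gt0.
pose W := w1 * v1 + w2 * v2.
(* Comparing opposite points isolates the linear terms: W v = j^2 w. Pairing with v gives W (|v|^2 -
   j^2) = 0, hence W = 0 and w = 0. *)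
have g1 : W * v1 = j ^+ 2 * w1.
  have := main 1 0; have := main (-1) 0; rewrite /W; lra.
have g2 : W * v2 = j ^+ 2 * w2.
  have := main 0 1; have := main 0 (-1); rewrite /W; lra.
have W0 : W = 0.
  have : W * (v1 ^+ 2 + v2 ^+ 2 - j ^+ 2) = 0.
    transitivity ((W * v1) * v1 + (W * v2) * v2 - j ^+ 2 * W); first by ring.
    by rewrite g1 g2 /W; ring.
  by move/eqP; rewrite mulf_eq0 => /orP[/eqP //|/eqP h]; exfalso; lra.
have w10 : w1 = 0.
  by move: g1; rewrite W0 mul0r => /esym/eqP; rewrite mulf_eq0 gt_eqF //= => /eqP.
have w20 : w2 = 0.
  by move: g2; rewrite W0 mul0r => /esym/eqP; rewrite mulf_eq0 gt_eqF //= => /eqP.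
move: main; rewrite w10 w20 => main.
have hE : e2 = l * e1 by have := main 0 0; lra.
have hxx : v1 ^+ 2 - j ^+ 2 = l * (u1 ^+ 2 - i ^+ 2) by have := main 1 0; lra.
have hyy : v2 ^+ 2 - j ^+ 2 = l * (u2 ^+ 2 - i ^+ 2) by have := main 0 1; lra.
have hxy : v1 * v2 = l * (u1 * u2) by have := main 1 1; lra.
(* determinants of the quadratic parts *)
have hdet : e2 = l ^+ 2 * e1.
  transitivity ((v1 * v2) ^+ 2 - (v1 ^+ 2 - j ^+ 2) * (v2 ^+ 2 - j ^+ 2)).
    by rewrite /e2; ring.
  by rewrite hxx hyy hxy /e1; ring.
have l1 : l = 1.
  have e1N0 : e1 != 0 by rewrite gt_eqF.
  by apply: (mulfI l0); apply: (mulIf e1N0); rewrite -expr2 -hdet hE mulr1.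
move: hxx hyy hxy hE; rewrite l1 !mul1r => hxx hyy hxy hE.
have hst : v1 ^+ 2 + v2 ^+ 2 = u1 ^+ 2 + u2 ^+ 2.
  apply/eqP; rewrite -(eqrXn2 (n := 2)) //; try lra.
  apply/eqP.
  (* The squared trace (|v|^2 - 2 j^2)^2 plus 4 e2 is |v|^4. *)
  transitivity ((v1 ^+ 2 - j ^+ 2 + (v2 ^+ 2 - j ^+ 2)) ^+ 2 + 4 * e2).
    by rewrite /e2; ring.
  by rewrite hxx hyy hE /e1; ring.
have hij : j ^+ 2 = i ^+ 2 by lra.
have q1 : (v1 - u1) * (v1 + u1) = 0 by rewrite -subr_sqr; lra.
have q2 : (v2 - u2) * (v2 + u2) = 0 by rewrite -subr_sqr; lra.
have huv : (v1 = u1 /\ v2 = u2) \/ (v1 = - u1 /\ v2 = - u2).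
  have [u10|u1N0] := eqVneq u1 0.
    have v10 : v1 = 0 by move: q1; rewrite u10 subr0 addr0 => /eqP; rewrite mulf_eq0 orbb => /eqP.
    move/eqP: q2; rewrite mulf_eq0 subr_eq0 addr_eq0 v10 u10 oppr0.
    by case/orP => /eqP ->; [left | right].
  move/eqP: q1; rewrite mulf_eq0 subr_eq0 addr_eq0 => /orP[] /eqP h; [left|right]; split=> //.
    by apply: (mulfI u1N0); rewrite -{1}h.
  by apply: (mulfI u1N0); rewrite mulrN -hxy h; ring.
move: huv w10 w20; rewrite /u1 /u2 /v1 /v2 /w1 /w2 => huv h1 h2.
case: huv => -[h3 h4]; [left|right]; split.
- by rewrite [A]surjective_pairing [C]surjective_pairing; congr pair; lra.
- by rewrite [B]surjective_pairing [D]surjective_pairing; congr pair; lra.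
- by rewrite [A]surjective_pairing [D]surjective_pairing; congr pair; lra.
- by rewrite [B]surjective_pairing [C]surjective_pairing; congr pair; lra.
Qed.

(** Both forms are conics through the five points, hence nonzero multiples of one function; being
    proportional, they share their foci. *)
Lemma hyperbolas_five A B C D (i j : R) P1 P2 P3 P4 P5 :
  0 < i -> i ^+ 2 < sqdist A B -> 0 < j -> j ^+ 2 < sqdist C D ->
  cross P1 P2 P3 != 0 -> cross P1 P2 P4 != 0 -> cross P1 P2 P5 != 0 ->
  cross P1 P3 P4 != 0 -> cross P1 P3 P5 != 0 -> cross P2 P4 P5 != 0 ->
  (forall P, P \in [:: P1; P2; P3; P4; P5] -> focal_form A B i P = 0 /\ focal_form C D j P = 0) ->
  (A = C /\ B = D) \/ (A = D /\ B = C).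
Proof.
move=> i0 iAB j0 jCD n123 n124 n125 n134 n135 n245 hP.
have [H hH] := conic_through_five n123 n124 n125 n134 n135 n245.
have [K1 hK1] := focal_form_conic A B i.
have [K2 hK2] := focal_form_conic C D j.
have [l1 hl1] : exists l, forall P, focal_form A B i P = l * H P.
  have [l hl] : exists l, forall P, conic_eval K1 P = l * H P.
    by apply: hH; rewrite hK1; apply: (fun h => (hP _ h).1); rewrite !inE eqxx ?orbT.
  by exists l => P; rewrite -hK1.
have [l2 hl2] : exists l, forall P, focal_form C D j P = l * H P.
  have [l hl] : exists l, forall P, conic_eval K2 P = l * H P.
    by apply: hH; rewrite hK2; apply: (fun h => (hP _ h).2); rewrite !inE eqxx ?orbT.
  by exists l => P; rewrite -hK2.
(* the hyperbola equation is negative at the centre *)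
have neg A' B' (k : R) : 0 < k -> k ^+ 2 < sqdist A' B' ->
  focal_form A' B' k ((A'.1 + B'.1) / 2, (A'.2 + B'.2) / 2) < 0.
  move=> k0 kAB.
  have -> : focal_form A' B' k ((A'.1 + B'.1) / 2, (A'.2 + B'.2) / 2) =
    - (k ^+ 2 * (sqdist A' B' - k ^+ 2)) by rewrite /focal_form /sqdist /=; field.
  by rewrite oppr_lt0 mulr_gt0 ?exprn_gt0 ?subr_gt0.
have l1N0 : l1 != 0.
  by apply/eqP => l0; have := neg _ _ _ i0 iAB; rewrite hl1 l0 mul0r ltxx.
have l2N0 : l2 != 0.
  by apply/eqP => l0; have := neg _ _ _ j0 jCD; rewrite hl2 l0 mul0r ltxx.
apply: (@focal_form_proportional A B C D i j (l2 / l1)) => //.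
  by rewrite mulf_neq0 ?invr_eq0.
by move=> P; rewrite hl1 hl2 mulrA divfK.
Qed.

End PlaneGeometry.

(** * Points with integral distances and even perimeters *)

(** With x, y, z sorted, the two smaller add up to the shortest side, which is at least t; the
    maximum is the longest side. *)
Lemma ravi_height_nat (x y z t : nat) :
  (0 < x)%N -> (0 < y)%N -> (0 < z)%N ->
  (t <= x + y)%N -> (t <= x + z)%N -> (t <= y + z)%N ->
  forall R : realFieldType,
  (2 * t%:R - 1) * (maxn (x + y) (maxn (x + z) (y + z)))%:R ^+ 2
  <= (4 * (x + y + z) * x * y * z)%:R :> R.
Proof.
move=> x0 y0 z0 hxy hxz hyz R.
have main (a b c : nat) : (0 < a)%N -> (a <= b)%N -> (b <= c)%N -> (t <= a + b)%N ->
  (2 * t%:R - 1) * (b + c)%:R ^+ 2 <= (4 * (a + b + c) * a * b * c)%:R :> R.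
  move=> a0 ab bc hab.
  have := @ravi_height R a%:R b%:R c%:R.
  rewrite ler1n !ler_nat => /(_ a0 ab bc).
  move=> h; rewrite !natrM !natrD; apply: le_trans h; apply: ler_wpM2r.
    by rewrite exprn_ge0 // addr_ge0.
  by rewrite lerD2r ler_pM2l // -natrD ler_nat.
have [xy|yx] := leqP x y; have [xz|zx] := leqP x z; have [yz|zy] := leqP y z; try lia.
- have -> : maxn (x + y) (maxn (x + z) (y + z)) = (y + z)%N by lia.
  exact: main.
- have -> : maxn (x + y) (maxn (x + z) (y + z)) = (z + y)%N by lia.
  have -> : (4 * (x + y + z) * x * y * z = 4 * (x + z + y) * x * z * y)%N by lia.
  by apply: main; lia.
- have -> : maxn (x + y) (maxn (x + z) (y + z)) = (x + y)%N by lia.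
  have -> : (4 * (x + y + z) * x * y * z = 4 * (z + x + y) * z * x * y)%N by lia.
  by apply: main; lia.
- have -> : maxn (x + y) (maxn (x + z) (y + z)) = (x + z)%N by lia.
  have -> : (4 * (x + y + z) * x * y * z = 4 * (y + x + z) * y * x * z)%N by lia.
  by apply: main; lia.
- have -> : maxn (x + y) (maxn (x + z) (y + z)) = (z + x)%N by lia.
  have -> : (4 * (x + y + z) * x * y * z = 4 * (y + z + x) * y * z * x)%N by lia.
  by apply: main; lia.
- have -> : maxn (x + y) (maxn (x + z) (y + z)) = (y + x)%N by lia.
  have -> : (4 * (x + y + z) * x * y * z = 4 * (z + y + x) * z * y * x)%N by lia.
  by apply: main; lia.
Qed.

Lemma card_le_fibers (T : finType) (S : {set T}) (f : T -> nat) (h c : nat) :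
  (forall P, P \in S -> f P < h)%N ->
  (forall a, #|[set P in S | f P == a]| <= c)%N -> (#|S| <= c * h)%N.
Proof.
elim: h S => [|h IH] S hf hc.
  rewrite muln0 leqn0 cards_eq0; apply/eqP/setP => P; rewrite inE.
  by apply/negP => /hf.
have -> : S = [set P in S | f P == h] :|: [set P in S | f P < h]%N.
  apply/setP => P; rewrite !inE -andb_orr -leq_eqVlt.
  by case: (boolP (P \in S)) => // /hf; rewrite ltnS => ->.
rewrite (leq_trans (leq_card_setU _ _)) // mulnS leq_add //.
apply: IH => [P|a]; first by rewrite inE => /andP[].
apply: leq_trans (hc a); apply: subset_leq_card; apply/subsetP => P.
by rewrite !inE => /andP[/andP[-> _]].
Qed.

Lemma card_le2 (T : finType) (S : {set T}) :
  (forall a b c, a \in S -> b \in S -> c \in S ->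
     a != b -> a != c -> b != c -> False) -> (#|S| <= 2)%N.
Proof.
move=> h; rewrite leqNgt; apply/negP => /card_gt2P[a [b [c [[ha hb hc]]]]].
by case=> ab bc ca; apply: (h a b c) => //; rewrite eq_sym.
Qed.

Section Configuration.
Variables (R : realFieldType) (n : nat).
Variables (p : 'I_n -> R * R) (D : 'I_n -> 'I_n -> nat).
Hypothesis p_inj : injective p.
Hypothesis hD : forall i j, (D i j)%:R ^+ 2 = sqdist (p i) (p j).
Hypothesis hcross : forall i j k, i != j -> i != k -> j != k ->
  cross (p i) (p j) (p k) != 0.
Hypothesis heven : forall i j k, i != j -> i != k -> j != k ->
  ~~ odd (D i j + D i k + D j k).

Lemma sqdistC (P Q : R * R) : sqdist P Q = sqdist Q P.
Proof. by rewrite /sqdist; ring. Qed.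

Lemma distC i j : D i j = D j i.
Proof.
apply/eqP; rewrite -(eqr_nat R) -(eqrXn2 (n := 2)) ?ler0n //.
by rewrite !hD sqdistC.
Qed.

(** Nondegeneracy makes Heron's product positive, so the triangle inequalities are strict; as the
    perimeter is even, the halves of b+c-a, a+c-b, a+b-c are positive integers. *)
Lemma ravi i j k : i != j -> i != k -> j != k ->
  exists x y z : nat, [/\ (0 < x)%N, (0 < y)%N & (0 < z)%N] /\
    [/\ D i j = (x + y)%N, D i k = (x + z)%N, D j k = (y + z)%N &
        cross (p i) (p j) (p k) ^+ 2 = (4 * (x + y + z) * x * y * z)%:R].
Proof.
move=> ij ik jk.
have c0 : 0 < cross (p i) (p j) (p k) ^+ 2 by rewrite exprn_even_gt0 //= hcross.
have := heron (hD j k) (hD i k) (hD i j).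
have := heven ij ik jk.
move: (D j k) (D i k) (D i j) => a b c ev hN.
have pos : 0 < (a%:R + b%:R + c%:R) * (b%:R + c%:R - a%:R) * (a%:R + c%:R - b%:R)
   * (a%:R + b%:R - c%:R) :> R by rewrite -hN mulr_gt0.
have tri (u v w : nat) : 0 < (u%:R + v%:R + w%:R) * (v%:R + w%:R - u%:R) *
   (u%:R + w%:R - v%:R) * (u%:R + v%:R - w%:R) :> R -> (u < v + w)%N.
  move=> h; rewrite ltnNge; apply/negP => le_u.
  have {}le_u : v%:R + w%:R <= u%:R :> R by rewrite -natrD ler_nat.
  have v0 : 0 <= v%:R :> R by []. have w0 : 0 <= w%:R :> R by [].
  have : 0 <= (u%:R + v%:R + w%:R) * (u%:R - (v%:R + w%:R)) *
   (u%:R + w%:R - v%:R) * (u%:R + v%:R - w%:R) :> R.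
    by rewrite !mulr_ge0 //; lra.
  by move: h; lra.
have ha : (a < b + c)%N by exact: tri.
have hb : (b < a + c)%N.
  by apply: tri; rewrite (_ : _ * _ = (a%:R + b%:R + c%:R) * (b%:R + c%:R - a%:R) * (a%:R + c%:R - b%:R)
   * (a%:R + b%:R - c%:R)) //; ring.
have hc : (c < a + b)%N.
  by apply: tri; rewrite (_ : _ * _ = (a%:R + b%:R + c%:R) * (b%:R + c%:R - a%:R) * (a%:R + c%:R - b%:R)
   * (a%:R + b%:R - c%:R)) //; ring.
have [x [y [z [ea eb ec]]]] : exists x y z, [/\ a = y + z, b = x + z & c = x + y]%N.
  by exists (b + c - a)./2, (a + c - b)./2, (a + b - c)./2; split; lia.
exists x, y, z; split; first by split; lia.
split=> //; apply: (@mulfI _ 4); first by rewrite pnatr_eq0.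
by rewrite hN ea eb ec !natrM !natrD; ring.
Qed.

(** For c the longest side, (2t-1) c^2 <= cross^2 <= width^2 c^2. *)
Lemma strip_width i j k (t : nat) : i != j -> i != k -> j != k ->
  (p i).1 <= (p j).1 -> (p j).1 <= (p k).1 ->
  (t <= D i j)%N -> (t <= D i k)%N -> (t <= D j k)%N ->
  2 * t%:R - 1 <= ((p k).1 - (p i).1) ^+ 2.
Proof.
move=> ij ik jk hij hjk tij tik tjk.
have [x [y [z [[x0 y0 z0] [eij eik ejk ecr]]]]] := ravi ij ik jk.
move: tij tik tjk; rewrite eij eik ejk => tij tik tjk.
have := @ravi_height_nat x y z t x0 y0 z0 tij tik tjk R; rewrite -ecr.
set c := maxn _ _ => h1.
have c0 : 0 < c%:R ^+ 2 :> R by rewrite exprn_gt0 // ltr0n /c; lia.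
have cij : (x + y <= c)%N by rewrite leq_max leqnn.
have cjk : (y + z <= c)%N by rewrite !leq_max leqnn !orbT.
have := @cross_le_width R (p i) (p j) (p k) c%:R hij hjk.
rewrite ler0n -!hD eij ejk !lerXn2r ?nnegrE ?ler0n ?ler_nat //.
move=> /(_ isT isT isT) h2.
by rewrite -(ler_pM2r c0); apply: le_trans h2.
Qed.

(** Subtraction is truncated, so one summand vanishes and the sum is the absolute difference of the
    distances from P to A and B. *)
Definition gap A B P : nat := (D A P - D B P) + (D B P - D A P).

(** In Ravi numbers the gap is |x - y|, while D A B = x + y with x, y >= 1. *)
Lemma gap_bound A B P : A != B -> P != A -> P != B ->
  (gap A B P + 2 <= D A B)%N /\ odd (gap A B P) = odd (D A B).
Proof.
move=> AB PA PB; rewrite eq_sym in PA; rewrite eq_sym in PB.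
have [x [y [z [[x0 y0 z0] [eij eik ejk _]]]]] := ravi AB PA PB.
by rewrite /gap eij eik ejk; lia.
Qed.

(** Gap 0 puts P on the perpendicular bisector of AB, which has at most two points of the set. For
    odd D A B the gap is odd, hence never 0. *)
Lemma gap0_card A B : A != B ->
  (#|[set P | [&& P != A, P != B & gap A B P == 0%N]]| <= 2 * ~~ odd (D A B))%N.
Proof.
move=> AB; have [oAB|eAB] := boolP (odd (D A B)).
  rewrite leqn0 cards_eq0; apply/eqP/setP => P; rewrite !inE.
  apply/negP => /and3P[PA PB /eqP g0].
  by have [_] := gap_bound AB PA PB; rewrite g0 oAB.
rewrite muln1; apply: card_le2 => P Q S; rewrite !inE.
move=> /and3P[PA PB gP] /and3P[QA QB gQ] /and3P[SA SB gS] PQ PS QS.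
have eqd T : gap A B T == 0%N -> sqdist (p T) (p A) = sqdist (p T) (p B).
  rewrite /gap addn_eq0 !subn_eq0 -eqn_leq => /eqP h.
  by rewrite -!hD (distC T A) h distC.
have /negP := hcross PQ PS QS; apply.
move: (eqd _ gP) (eqd _ gQ) (eqd _ gS); rewrite /sqdist => hP hQ hS.
pose u1 := (p B).1 - (p A).1; pose u2 := (p B).2 - (p A).2.
have eQ : ((p Q).1 - (p P).1) * u1 + ((p Q).2 - (p P).2) * u2 = 0.
  by rewrite /u1 /u2; lra.
have eS : ((p S).1 - (p P).1) * u1 + ((p S).2 - (p P).2) * u2 = 0.
  by rewrite /u1 /u2; lra.
(* PQ and PS are orthogonal to u = B - A, so cross times u is 0, while u is nonzero. *)
have h1 : cross (p P) (p Q) (p S) * u1 = 0.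
  transitivity (((p S).2 - (p P).2) * 0 - ((p Q).2 - (p P).2) * 0); last by ring.
  by rewrite -{1}eQ -eS /cross; ring.
have h2 : cross (p P) (p Q) (p S) * u2 = 0.
  transitivity (((p Q).1 - (p P).1) * 0 - ((p S).1 - (p P).1) * 0); last by ring.
  by rewrite -{1}eS -eQ /cross; ring.
move/eqP: h1; rewrite mulf_eq0 => /orP[//|/eqP u10].
move/eqP: h2; rewrite mulf_eq0 => /orP[//|/eqP u20].
case/negP: AB; apply/eqP/p_inj.
rewrite [LHS]surjective_pairing [RHS]surjective_pairing.
by move: u10 u20; rewrite /u1 /u2 => ? ?; congr pair; lra.
Qed.

(** Five such points would lie on two hyperbolas with different foci. For i = 0 or j = 0 the form
    would degenerate to a double line. *)
Lemma fiber_card A B C E (i j : nat) : A != B -> C != E ->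
  ~ (A = C /\ B = E) -> ~ (A = E /\ B = C) -> (0 < i)%N -> (0 < j)%N ->
  (#|[set P | [&& P != A, P != B, P != C, P != E, gap A B P == i &
        gap C E P == j]]| <= 4)%N.
Proof.
move=> AB CE nAC nAE i0 j0; rewrite leqNgt; apply/negP; rewrite cardE.
set S := [set P | _]; have := enum_uniq S; have := mem_enum S.
case: (enum S) => [|P1 [|P2 [|P3 [|P4 [|P5 l]]]]] //= mS.
rewrite !inE !negb_or -!andbA.
move=> /and5P[n12 n13 n14 n15 /and5P[_ n23 n24 n25 /and4P[_ n34 n35 /and3P[_ n45 _]]]] _.
have hS P : P \in [:: P1; P2; P3; P4; P5] ->
   [&& P != A, P != B, P != C, P != E, gap A B P == i & gap C E P == j].
  move=> hP; have := mS P; rewrite [X in _ = X]inE => <-.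
  by move: hP; rewrite !inE => /or4P[->|->|->|/orP[]->]; rewrite ?orbT.
have focal0 A' B' P (k : nat) : gap A' B' P == k -> focal_form (p A') (p B') k%:R (p P) = 0.
  move=> /eqP <-; apply: focal_form_eq0 (hD P A') (hD P B') _; rewrite (distC P) (distC P B').
  rewrite /gap; have [h|/ltnW h] := leqP (D A' P) (D B' P).
    by rewrite (eqP h) add0n natrB // -sqrrN opprB.
  by rewrite (eqP h) addn0 natrB.
have ltD A' B' P (k : nat) : A' != B' -> P != A' -> P != B' -> gap A' B' P == k ->
   k%:R ^+ 2 < sqdist (p A') (p B').
  move=> AB' PA PB /eqP <-; rewrite -hD ltrXn2r ?nnegrE ?ler0n //.
  rewrite ltr_nat; have [h _] := gap_bound AB' PA PB.
  by apply: leq_trans h; rewrite addn2 ltnS leqnSn.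
have /and5P[a1 a2 a3 a4 /andP[a5 a6]] := hS P1 (mem_head _ _).
have := @hyperbolas_five R (p A) (p B) (p C) (p E) i%:R j%:R
  (p P1) (p P2) (p P3) (p P4) (p P5).
rewrite !ltr0n i0 j0 => /(_ isT (ltD _ _ _ _ AB a1 a2 a5) isT (ltD _ _ _ _ CE a3 a4 a6)).
move=> /(_ (hcross n12 n13 n23) (hcross n12 n14 n24) (hcross n12 n15 n25)).
move=> /(_ (hcross n13 n14 n34) (hcross n13 n15 n35) (hcross n24 n25 n45)).
case.
- move=> P hP.
  have [Q hQ ->] : exists2 Q, Q \in [:: P1; P2; P3; P4; P5] & P = p Q.
    by apply/mapP.
  by have /and5P[_ _ _ _ /andP[b5 b6]] := hS Q hQ; split; apply: focal0.
- by case=> /p_inj h1 /p_inj h2; apply: nAC.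
- by case=> /p_inj h1 /p_inj h2; apply: nAE.
Qed.

(** A point is one of A, B, C, E, or lies on one of two bisectors, or has two positive gaps. A
    positive gap has the parity of the distance s and is at most s-2, which leaves [s.-1./2]
    values. *)
Lemma card_two_hyperbolas A B C E : A != B -> C != E ->
  ~ (A = C /\ B = E) -> ~ (A = E /\ B = C) ->
  (n <= 4 + 2 * ~~ odd (D A B) + 2 * ~~ odd (D C E)
        + 4 * ((D A B).-1./2 * (D C E).-1./2))%N.
Proof.
move=> AB CE nAC nAE.
pose Z A B := [set P | [&& P != A, P != B & gap A B P == 0%N]].
pose S := [set P | [&& P != A, P != B, P != C & P != E] &&
                   ((0 < gap A B P) && (0 < gap C E P))%N].
have cov : [set: 'I_n] \subset [set A; B; C; E] :|: Z A B :|: Z C E :|: S.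
  apply/subsetP => P _; rewrite !inE.
  case: (eqVneq P A) => //= ?; case: (eqVneq P B) => //= ?.
  case: (eqVneq P C) => //= ?; case: (eqVneq P E) => //= ?.
  by rewrite !lt0n; case: eqP => //=; case: eqP.
have cS : (#|S| <= 4 * (D C E).-1./2 * (D A B).-1./2)%N.
  apply: (@card_le_fibers _ _ (fun P => (gap A B P).-1./2)).
    move=> P; rewrite !inE => /andP[/and4P[PA PB PC PE] /andP[g1 g2]].
    by have [] := gap_bound AB PA PB; lia.
  move=> a; apply: (@card_le_fibers _ _ (fun P => (gap C E P).-1./2)).
    move=> P; rewrite !inE => /andP[/andP[/and4P[PA PB PC PE] /andP[g1 g2]] _].
    by have [] := gap_bound CE PC PE; lia.
  move=> b.
  (* The index a = (gap-1)/2, rounded down, and the parity of D A B recover the gap. *)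
  pose i1 := (if odd (D A B) then a.*2.+1 else a.*2.+2)%N.
  pose j1 := (if odd (D C E) then b.*2.+1 else b.*2.+2)%N.
  apply: leq_trans (fiber_card (i := i1) (j := j1) AB CE nAC nAE _ _);
    [|by rewrite /i1; case: ifP|by rewrite /j1; case: ifP].
  apply: subset_leq_card; apply/subsetP => P; rewrite !inE.
  move=> /andP[/andP[/andP[/and4P[PA PB PC PE] /andP[g1 g2]] /eqP ea] /eqP eb].
  have [_ o1] := gap_bound AB PA PB; have [_ o2] := gap_bound CE PC PE.
  rewrite PA PB PC PE /= /i1 /j1 -o1 -o2; apply/andP; split; apply/eqP.
    by clear -ea g1; move: ea g1; case: ifP; lia.
  by clear -eb g2; move: eb g2; case: ifP; lia.
have := subset_leq_card cov; rewrite cardsT card_ord => /leq_trans; apply.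
have c4 : (#|[set A; B; C; E]| <= 4)%N.
  have h (X : {set 'I_n}) k Q : (#|X| <= k)%N -> (#|X :|: [set Q]| <= k.+1)%N.
    by move=> hX; rewrite (leq_trans (leq_card_setU _ _)) // cards1 addn1 ltnS.
  by do 3 apply: (h); rewrite cards1.
rewrite (leq_trans (leq_card_setU _ _)) // leq_add //; last by rewrite (mulnC (D A B).-1./2) mulnA.
rewrite (leq_trans (leq_card_setU _ _)) // leq_add ?gap0_card //.
by rewrite (leq_trans (leq_card_setU _ _)) // leq_add ?gap0_card.
Qed.

End Configuration.

(** * Point sets with a pair at distance 2, 3 or 4 *)

(** Binary numbers keep the evaluation of the finite tables below cheap. *)
Definition is_squareN (c : N) : bool := N.eqb (N.sqrt c * N.sqrt c)%num c.

Lemma is_squareNP (k c : nat) : (k * k)%N = c -> is_squareN (N.of_nat c).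
Proof.
move=> <-; rewrite /is_squareN -[(k * k)%N]/(Nat.mul k k) Nnat.Nat2N.inj_mul.
by rewrite N.sqrt_square N.eqb_refl.
Qed.

(** For s = x + y and fixed xy the squared area is proportional to z(z+s), so this tests whether two
    such triangles have rational area ratio. *)
Definition square_pair (s z z' : nat) : bool :=
  let a := N.of_nat z in let b := N.of_nat z' in let c := N.of_nat s in
  is_squareN (a * (a + c) * (b * (b + c)))%num.

Lemma square_pairP s z z' k : (k ^ 2 = z * (z + s) * (z' * (z' + s)))%N ->
  square_pair s z z'.
Proof.
move=> h; have := @is_squareNP k _ h.
rewrite -[X in N.of_nat X]/(Nat.mul (Nat.mul z (Nat.add z s)) (Nat.mul z' (Nat.add z' s))).
by rewrite !Nnat.Nat2N.inj_mul !Nnat.Nat2N.inj_add.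
Qed.

(** The one coincidence is 2*5 = 10 and 5*8 = 40, with product 20^2. *)
Lemma square_pair3 z z' : (2 <= z <= 9)%N -> (2 <= z' <= 9)%N ->
  square_pair 3 z z' -> z = z' \/ (z = 2 /\ z' = 5) \/ (z = 5 /\ z' = 2).
Proof.
move=> hz hz' h.
have /allP/(_ z)/[!mem_iota]/(_ hz) /allP/(_ z')/[!mem_iota]/(_ hz') :
  all (fun z => all (fun z' => square_pair 3 z z' ==>
    [|| z == z', (z == 2) && (z' == 5) | (z == 5) && (z' == 2)]) (iota 2 8)) (iota 2 8).
  by vm_compute.
rewrite h /= => /or3P[/eqP|/andP[/eqP ? /eqP ?]|/andP[/eqP ? /eqP ?]]; by [left|right;left|right;right].
Qed.

Lemma square_pair4 z z' : (3 <= z <= 11)%N -> (3 <= z' <= 11)%N ->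
  square_pair 4 z z' -> z = z'.
Proof.
move=> hz hz' h.
have /allP/(_ z)/[!mem_iota]/(_ hz) /allP/(_ z')/[!mem_iota]/(_ hz') :
  all (fun z => all (fun z' => square_pair 4 z z' ==> (z == z')) (iota 3 9)) (iota 3 9).
  by vm_compute.
by rewrite h /= => /eqP.
Qed.

Section SmallBase.
Variables (R : realFieldType) (n : nat).
Variables (p : 'I_n -> R * R) (D : 'I_n -> 'I_n -> nat).
Hypothesis p_inj : injective p.
Hypothesis hD : forall i j, (D i j)%:R ^+ 2 = sqdist (p i) (p j).
Hypothesis hcross : forall i j k, i != j -> i != k -> j != k ->
  cross (p i) (p j) (p k) != 0.
Hypothesis heven : forall i j k, i != j -> i != k -> j != k ->
  ~~ odd (D i j + D i k + D j k).

(** [xc] and [yc] are 2|AB| times the Cartesian coordinates of P with origin at the midpoint of AB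
    and first axis along AB. *)
Let xc A B P : R := sqdist (p P) (p A) - sqdist (p P) (p B).
Let yc A B P : R := 2 * cross (p A) (p B) (p P).

Lemma coord_sqdist A B P Q :
  (2 * sqdist (p A) (p B) * ((p P).1 - (p Q).1) =
    (xc A B P - xc A B Q) * ((p B).1 - (p A).1)
    - (yc A B P - yc A B Q) * ((p B).2 - (p A).2)) /\
  (2 * sqdist (p A) (p B) * ((p P).2 - (p Q).2) =
    (xc A B P - xc A B Q) * ((p B).2 - (p A).2)
    + (yc A B P - yc A B Q) * ((p B).1 - (p A).1)).
Proof. by rewrite /xc /yc /sqdist /cross; split; ring. Qed.

Lemma sqdist_neq0 A B : A != B -> sqdist (p A) (p B) != 0.
Proof.
apply: contraNneq => h; apply/eqP/p_inj.
move/eqP: h; rewrite /sqdist paddr_eq0 ?sqr_ge0 // !sqrf_eq0 !subr_eq0.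
by move=> /andP[/eqP h1 /eqP h2]; rewrite [LHS]surjective_pairing h1 h2 -surjective_pairing.
Qed.

Lemma coord_inj A B P Q : A != B -> xc A B P = xc A B Q -> yc A B P = yc A B Q -> P = Q.
Proof.
move=> AB hx hy; apply: p_inj.
have [] := coord_sqdist A B P Q; rewrite hx hy !subrr !mul0r subrr addr0.
have s0 := sqdist_neq0 AB.
move=> /eqP; rewrite !mulf_eq0 pnatr_eq0 (negbTE s0) /= subr_eq0 => /eqP h1.
move=> /eqP; rewrite !mulf_eq0 pnatr_eq0 (negbTE s0) /= subr_eq0 => /eqP h2.
by rewrite [LHS]surjective_pairing h1 h2 -surjective_pairing.
Qed.

(* P and Q are symmetric about the midpoint of AB, so APBQ is a parallelogram. *)
Lemma antipodal A B P Q : A != B ->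
  xc A B Q = - xc A B P -> yc A B Q = - yc A B P ->
  (D P Q ^ 2 + D A B ^ 2 = 2 * (D A P ^ 2 + D B P ^ 2))%N.
Proof.
move=> AB hx hy; apply/eqP; rewrite -(eqr_nat R) natrM !natrD !natrX !hD.
have s0 := sqdist_neq0 AB.
have h1 : (p Q).1 = (p A).1 + (p B).1 - (p P).1.
  apply/eqP; rewrite -subr_eq0 -(mulrI_eq0 _ (mulfI s0)) -(mulrI_eq0 _ (@mulfI _ 2 _)) ?pnatr_eq0 //.
  apply/eqP; transitivity ((xc A B Q + xc A B P) * ((p B).1 - (p A).1)
    - (yc A B Q + yc A B P) * ((p B).2 - (p A).2)).
    by rewrite /xc /yc /sqdist /cross; ring.
  by rewrite hx hy !addNr !mul0r subrr.
have h2 : (p Q).2 = (p A).2 + (p B).2 - (p P).2.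
  apply/eqP; rewrite -subr_eq0 -(mulrI_eq0 _ (mulfI s0)) -(mulrI_eq0 _ (@mulfI _ 2 _)) ?pnatr_eq0 //.
  apply/eqP; transitivity ((xc A B Q + xc A B P) * ((p B).2 - (p A).2)
    + (yc A B Q + yc A B P) * ((p B).1 - (p A).1)).
    by rewrite /xc /yc /sqdist /cross; ring.
  by rewrite hx hy !addNr !mul0r addr0.
by rewrite /sqdist h1 h2; apply/eqP; ring.
Qed.

Definition base_sides A B P (a b : nat) : Prop :=
  (D A P = a /\ D B P = b) \/ (D A P = b /\ D B P = a).

(** The unordered pair of distances fixes xc^2 = (a^2 - b^2)^2 and, by Heron's formula, yc^2. *)
Lemma coord_sqr A B P Q a b : base_sides A B P a b -> base_sides A B Q a b ->
  (xc A B Q = xc A B P \/ xc A B Q = - xc A B P) /\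
  (yc A B Q = yc A B P \/ yc A B Q = - yc A B P).
Proof.
have sq (x y : R) : x ^+ 2 = y ^+ 2 -> x = y \/ x = - y.
  by move/eqP; rewrite eqf_sqr => /orP[] /eqP; [left|right].
have hx S : base_sides A B S a b -> xc A B S ^+ 2 = (a%:R ^+ 2 - b%:R ^+ 2) ^+ 2.
  by rewrite /xc => -[] [<- <-]; rewrite !hD ![sqdist (p S) _]sqdistC; ring.
have hy S : base_sides A B S a b -> yc A B S ^+ 2 =
    (a%:R + b%:R + (D A B)%:R) * (b%:R + (D A B)%:R - a%:R)
    * (a%:R + (D A B)%:R - b%:R) * (a%:R + b%:R - (D A B)%:R).
  move=> hS; rewrite /yc exprMn -natrX (heron (hD B S) (hD A S) (hD A B)).
  by case: hS => -[-> ->]; ring.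
by move=> hP hQ; split; apply: sq; rewrite ?(hx _ hP) ?(hx _ hQ) ?(hy _ hP) ?(hy _ hQ).
Qed.

(* Up to symmetry in AB and in its perpendicular bisector there is one point
   with given unordered pair of distances to A and B. *)
Lemma base_sides_card A B (a b : nat) : A != B ->
  (forall k, k ^ 2 + D A B ^ 2 != 2 * (a ^ 2 + b ^ 2))%N ->
  forall S : {set 'I_n}, (forall P, P \in S -> base_sides A B P a b) -> (#|S| <= 2)%N.
Proof.
move=> AB hk S hS; apply: card_le2 => P Q T /hS hP /hS hQ /hS hT PQ PT QT.
have nanti U V : base_sides A B U a b -> xc A B V = - xc A B U ->
   yc A B V = - yc A B U -> False.
  move=> hU hx hy; have := antipodal AB hx hy; move/eqP.
  case: hU => -[-> ->]; first exact/negP.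
  by rewrite [(b ^ 2 + _)%N]addnC; exact/negP.
have [xQ yQ] := coord_sqr hP hQ; have [xT yT] := coord_sqr hP hT.
have eqQ := @coord_inj A B P Q AB; have eqT := @coord_inj A B P T AB.
have eqQT := @coord_inj A B Q T AB.
(* Relative to P, changing no sign gives P itself and changing both is excluded; the two single
   changes are antipodal to each other. *)
case: xQ yQ xT yT => xQ [] yQ [] xT [] yT;
  try (by case/eqP: PQ; apply: eqQ); try (by case/eqP: PT; apply: eqT);
  try (by apply: (nanti P Q)); try (by apply: (nanti P T));
  try (by case/eqP: QT; apply: eqQT; congruence).
- by apply: (nanti Q T) => //; rewrite ?xT ?xQ ?yT ?yQ ?opprK.
- by apply: (nanti Q T) => //; rewrite ?xT ?xQ ?yT ?yQ ?opprK.
Qed.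

(** With m = 4xy, (c c')^2 = m^2 z(z+s) z'(z'+s), while 8 c c' is an integer K. Hence (8m)^2 divides
    K^2 and the quotient is a square. *)
Lemma sides_square_pair A B P Q (x y x' y' z z' : nat) : A != B ->
  (0 < x)%N -> (0 < y)%N ->
  D A B = (x + y)%N -> D A P = (x + z)%N -> D B P = (y + z)%N ->
  D A B = (x' + y')%N -> D A Q = (x' + z')%N -> D B Q = (y' + z')%N ->
  (x * y = x' * y')%N ->
  exists k, (k ^ 2 = z * (z + D A B) * (z' * (z' + D A B)))%N.
Proof.
move=> AB x0 y0 es ea eb es' ea' eb' exy; set s := D A B.
set c := cross (p A) (p B) (p P); set c' := cross (p A) (p B) (p Q).
have hc : c ^+ 2 = (4 * (x * y) * (z * (z + s)))%:R.
  apply: (@mulfI _ 4); first by rewrite pnatr_eq0.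
  rewrite (heron (hD B P) (hD A P) (hD A B)) /s ea eb es !natrM !natrD; ring.
have hc' : c' ^+ 2 = (4 * (x * y) * (z' * (z' + s)))%:R.
  apply: (@mulfI _ 4); first by rewrite pnatr_eq0.
  rewrite exy (heron (hD B Q) (hD A Q) (hD A B)) /s ea' eb' es' !natrM !natrD; ring.
pose m := (4 * (x * y))%N.
(* This solves (xc P - xc Q)^2 + (yc P - yc Q)^2 = 4 |AB|^2 |PQ|^2 for the mixed term 8 c c'; all
   other terms are integers. *)
pose K : int := ((D A P)%:Z ^+ 2 - (D B P)%:Z ^+ 2 - (D A Q)%:Z ^+ 2 + (D B Q)%:Z ^+ 2) ^+ 2
  + (4 * (m * (z * (z + s))))%:Z + (4 * (m * (z' * (z' + s))))%:Z
  - 4 * (s%:Z ^+ 2 * (D P Q)%:Z ^+ 2).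
have hK : K%:~R = 8 * c * c' :> R.
  transitivity ((sqdist (p A) (p P) - sqdist (p B) (p P) - sqdist (p A) (p Q)
      + sqdist (p B) (p Q)) ^+ 2 + 4 * c ^+ 2 + 4 * c' ^+ 2
      - 4 * (sqdist (p A) (p B) * sqdist (p P) (p Q))); last first.
    by rewrite /c /c' /sqdist /cross; ring.
  rewrite hc hc' -!hD /K /m -/s.
  by rewrite !(rmorphB, rmorphD, rmorphM, rmorphXn) /= -!pmulrn; ring.
have hK2 : (`|K| ^ 2 = (8 * m) ^ 2 * (z * (z + s) * (z' * (z' + s))))%N.
  apply/eqP; rewrite -(eqr_nat R) -abszX natr_absz ger0_norm ?sqr_ge0 //.
  rewrite rmorphXn /= hK !exprMn hc hc' /m; apply/eqP; by rewrite !natrM; ring.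
have m0 : (0 < 8 * m)%N by rewrite /m !muln_gt0 x0 y0.
have : ((8 * m) ^ 2 %| `|K| ^ 2)%N by rewrite hK2 dvdn_mulr.
rewrite dvdn_pexp2r // => /dvdnP[k ek]; exists k; apply/eqP.
by rewrite -(eqn_pmul2r (m := (8 * m) ^ 2)) ?expn_gt0 ?m0 // -expnMn -ek hK2 mulnC.
Qed.

Lemma card_cover A B (S : {set 'I_n}) k : (forall P, P != A -> P != B -> P \in S) ->
  (#|S| <= k)%N -> (n <= k + 2)%N.
Proof.
move=> hS hk; rewrite -[X in (X <= _)%N]card_ord -cardsT.
have : [set: 'I_n] \subset S :|: [set A; B].
  apply/subsetP => P _; rewrite !inE.
  by case: eqVneq => [|PA]; rewrite ?orbT //; case: eqVneq => [|PB]; rewrite ?orbT // hS.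
move=> /subset_leq_card/leq_trans; apply; rewrite (leq_trans (leq_card_setU _ _)) // leq_add //.
by rewrite cards2; case: eqP.
Qed.

(** The equilateral triangle of side 2 has characteristic 3 but even perimeter, so [heven] does not
    exclude it. *)
Hypothesis h222 : forall i j k, i != j -> i != k -> j != k ->
  ~ [/\ D i j = 2, D i k = 2 & D j k = 2].

(** * Configurations with shortest distance 2, 3 or 4 *)

Section Base.
Variables (A B : 'I_n) (d : nat).
Hypothesis AB : A != B.
Hypothesis hmin : forall i j, i != j -> (D A B <= D i j)%N.
Hypothesis hmax : forall i j, (D i j <= d)%N.

Lemma ravi_base P : P != A -> P != B -> exists x y z : nat,
  [/\ (0 < x)%N, (0 < y)%N & (0 < z)%N] /\
  [/\ D A B = (x + y)%N, D A P = (x + z)%N & D B P = (y + z)%N].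
Proof.
rewrite ![P == _]eq_sym => PA PB; have [x [y [z [h [h1 h2 h3 _]]]]] := ravi hD hcross heven AB PA PB.
by exists x, y, z.
Qed.

(** Here x = y = 1, so all other points lie on the perpendicular bisector of AB. *)
Lemma base2_card : D A B = 2 -> (n <= 4)%N.
Proof.
move=> s2; have := gap0_card p_inj hD hcross heven AB; rewrite s2 /= => h.
apply: card_cover h => P PA PB; rewrite inE PA PB /=.
have [x [y [z [[x0 y0 z0] [h1 h2 h3]]]]] := ravi_base PA PB.
by rewrite /gap h2 h3; apply/eqP; lia.
Qed.

(** If d <= 3, each other point has z = 2, since z = 1 is the excluded equilateral triangle. Two
    such points are mirror images in AB at squared distance 32, not a square. *)
Lemma base2_diam : D A B = 2 -> n = 4 -> (4 <= d)%N.
Proof.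
move=> s2 n4; rewrite leqNgt; apply/negP => d3.
suff : (n <= 1 + 2)%N by rewrite n4.
apply: (@card_cover A B [set P | (P != A) && (P != B)]) => [P PA PB|].
  by rewrite inE PA PB.
have sides P : P != A -> P != B -> D A P = 3 /\ D B P = 3.
  move=> PA PB; have [x [y [z [[x0 y0 z0] [h1 h2 h3]]]]] := ravi_base PA PB.
  have := hmax A P => hAP.
  have z2 : z != 1%N.
    apply/eqP => z1; apply: (@h222 A B P) => //; rewrite 1?eq_sym //; by split; lia.
  by lia.
rewrite leqNgt; apply/negP => /card_gt1P[P [Q []]]; rewrite !inE.
move=> /andP[PA PB] /andP[QA QB] PQ.
have [a1 a2] := sides _ PA PB; have [b1 b2] := sides _ QA QB.
have x0 T : D A T = 3 -> D B T = 3 -> xc A B T = 0.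
  by move=> h1 h2; rewrite /xc ![sqdist (p T) _]sqdistC -!hD h1 h2 subrr.
have hP : base_sides A B P 3 3 by left.
have hQ : base_sides A B Q 3 3 by left.
have [_ [] hy] := coord_sqr hP hQ.
  by case/eqP: PQ; apply: (coord_inj AB); rewrite ?x0.
have := antipodal AB _ hy; rewrite !x0 // oppr0 => /(_ erefl).
rewrite a1 a2 s2 => h; have : (D P Q ^ 2 = 32)%N by lia.
move: (D P Q) (hmax P Q) => k hk; have : (k <= 3)%N by lia.
by case: k {hk} => [|[|[|[|]]]].
Qed.

Let others := [set P | (P != A) && (P != B)].
(** The Ravi number z of the triangle ABP. *)
Let zpar P := (D A P + D B P - D A B)./2.

Lemma others_cover k : (#|others| <= k)%N -> (n <= k + 2)%N.
Proof. by move=> hk; apply: (@card_cover A B) hk => P PA PB; rewrite inE PA PB. Qed.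

(** Here {x, y} = {1, 2}; minimality of AB gives 1 + z >= 3, and 2 + z <= d. *)
Lemma base3_sides P : D A B = 3 -> P \in others -> exists x y : nat,
  [/\ (0 < x)%N, (0 < y)%N, (x * y = 2)%N & D A B = (x + y)%N] /\
  [/\ D A P = (x + zpar P)%N, D B P = (y + zpar P)%N, (2 <= zpar P)%N & (zpar P + 2 <= d)%N].
Proof.
move=> s3; rewrite inE => /andP[PA PB].
have [x [y [z [[x0 y0 z0] [h1 h2 h3]]]]] := ravi_base PA PB.
have ez : zpar P = z by rewrite /zpar h1 h2 h3; lia.
rewrite eq_sym in PA; rewrite eq_sym in PB.
have m1 := hmin PA; have m2 := hmin PB; have n1 := hmax A P; have n2 := hmax B P.
have [[ex ey]|[ex ey]] : (x = 1 /\ y = 2 \/ x = 2 /\ y = 1)%N by lia.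
  by exists x, y; rewrite ez; split; split; try lia.
by exists x, y; rewrite ez; split; split; try lia.
Qed.

(** A nonzero gap excludes x = y = 2 and leaves {x, y} = {1, 3}; then 1 + z >= 4 and 3 + z <= d. *)
Lemma base4_sides P : D A B = 4 -> P \in others -> gap D A B P != 0%N -> exists x y : nat,
  [/\ (0 < x)%N, (0 < y)%N, (x * y = 3)%N & D A B = (x + y)%N] /\
  [/\ D A P = (x + zpar P)%N, D B P = (y + zpar P)%N, (3 <= zpar P)%N & (zpar P + 3 <= d)%N].
Proof.
move=> s4; rewrite inE => /andP[PA PB] g0.
have [x [y [z [[x0 y0 z0] [h1 h2 h3]]]]] := ravi_base PA PB.
have ez : zpar P = z by rewrite /zpar h1 h2 h3; lia.
move: g0; rewrite /gap h2 h3 => g0.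
rewrite eq_sym in PA; rewrite eq_sym in PB.
have m1 := hmin PA; have m2 := hmin PB; have n1 := hmax A P; have n2 := hmax B P.
have [[ex ey]|[ex ey]] : (x = 1 /\ y = 3 \/ x = 3 /\ y = 1)%N by lia.
  by exists x, y; rewrite ez; split; split; try lia.
by exists x, y; rewrite ez; split; split; try lia.
Qed.

Lemma base3_class z : D A B = 3 -> (#|[set P in others | zpar P == z]| <= 2)%N.
Proof.
move=> s3; have [z2|z2] := leqP 2 z; last first.
  rewrite (_ : [set _ in _ | _] = set0) ?cards0 //.
  apply/setP => P; rewrite !inE; apply/negP => /andP[hP /eqP ez].
  have [|x [y [_ [_ _]]]] := @base3_sides P s3; first by rewrite inE.
  by rewrite ez leqNgt z2.
apply: (@base_sides_card A B (z + 2) (z + 1) AB) => [k|P].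
  apply/eqP; rewrite s3 => h.
  (* A diagonal k satisfies k^2 = (2z+3)^2 - 8, which forces z = 0. *)
  have [e he] : exists e, (2 * z + 3 = k + e)%N by exists (2 * z + 3 - k)%N; nia.
  have h2 : (e * (e + 2 * k) = 8)%N by nia.
  by case: e he h2 => [|[|[|e]]] he h2; nia.
rewrite inE => /andP[hP /eqP <-].
have [x [y [[x0 y0 xy sxy] [e1 e2 _ _]]]] := base3_sides s3 hP.
rewrite /base_sides e1 e2.
have [[-> ->]|[-> ->]] : (x = 2 /\ y = 1 \/ x = 1 /\ y = 2)%N by lia.
  by left; split; lia.
by right; split; lia.
Qed.

Lemma base4_class z : D A B = 4 ->
  (#|[set P in [set P in others | gap D A B P != 0%N] | zpar P == z]| <= 2)%N.
Proof.
move=> s4; have [z2|z2] := leqP 3 z; last first.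
  rewrite (_ : [set _ in _ | _] = set0) ?cards0 //.
  apply/setP => P; rewrite !inE; apply/negP => /andP[/andP[hP hg] /eqP ez].
  have [|x [y [_ [_ _]]]] := @base4_sides P s4 _ hg; first by rewrite inE.
  by rewrite ez leqNgt z2.
apply: (@base_sides_card A B (z + 3) (z + 1) AB) => [k|P].
  apply/eqP; rewrite s4 => h.
  (* Here k^2 = (2z+4)^2 - 12, which again forces z = 0. *)
  have [e he] : exists e, (2 * z + 4 = k + e)%N by exists (2 * z + 4 - k)%N; nia.
  have h2 : (e * (e + 2 * k) = 12)%N by nia.
  by case: e he h2 => [|[|[|[|e]]]] he h2; nia.
rewrite inE => /andP[]; rewrite inE => /andP[hP hg] /eqP <-.
have [x [y [[x0 y0 xy sxy] [e1 e2 _ _]]]] := base4_sides s4 hP hg.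
rewrite /base_sides e1 e2.
have [[-> ->]|[-> ->]] : (x = 3 /\ y = 1 \/ x = 1 /\ y = 3)%N.
  by clear -xy sxy s4 x0 y0; nia.
  by left; split; lia.
by right; split; lia.
Qed.

(** Both triangles have xy = 2, so the square test applies, with z <= 9 from d <= 11. *)
Lemma base3_zpar P Q : D A B = 3 -> (d <= 11)%N -> P \in others -> Q \in others ->
  zpar P = zpar Q \/ (zpar P = 2 /\ zpar Q = 5) \/ (zpar P = 5 /\ zpar Q = 2).
Proof.
move=> s3 d11 hP hQ.
have [x [y [[x0 y0 xy sxy] [e1 e2 l1 u1]]]] := base3_sides s3 hP.
have [x' [y' [[x0' y0' xy' sxy'] [e1' e2' l1' u1']]]] := base3_sides s3 hQ.
have [k hk] := sides_square_pair AB x0 y0 sxy e1 e2 sxy' e1' e2' (etrans xy (esym xy')).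
by apply: square_pair3; [lia|lia|apply: (square_pairP (k := k)); rewrite hk s3].
Qed.

(** Either some z lies outside {2, 5} and all points share it, or only the classes 2 and 5 occur;
    each class has at most two points. *)
Lemma base3_card : D A B = 3 -> (d <= 11)%N -> (n <= 6)%N.
Proof.
move=> s3 d11; apply: (@others_cover 4).
have cl := fun z => base3_class z s3.
have [/exists_inP[P hP hz]|] := boolP [exists P in others, (zpar P != 2) && (zpar P != 5)].
  apply: leq_trans (_ : 2 <= 4)%N => //; apply: leq_trans (cl (zpar P)).
  apply: subset_leq_card; apply/subsetP => Q hQ; rewrite inE hQ /=.
  by have [->//|[[_ h]|[_ h]]] := base3_zpar s3 d11 hQ hP; rewrite h in hz.
move/exists_inPn => h.
apply: leq_trans (_ : #|[set P in others | zpar P == 2] :|: [set P in others | zpar P == 5]| <= _)%N.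
  apply: subset_leq_card; apply/subsetP => Q hQ; have := h Q hQ.
  rewrite negb_and !negbK in_setU => hz; apply/orP.
  by case/orP: hz => hz; [left | right]; rewrite inE hQ hz.
by rewrite (leq_trans (leq_card_setU _ _)) // (leq_add (cl 2) (cl 5)).
Qed.

(** Now z <= 4 rules out z = 5, so one class remains. *)
Lemma base3_card6 : D A B = 3 -> (d <= 6)%N -> (n <= 4)%N.
Proof.
move=> s3 d6; apply: (@others_cover 2).
have [->|[P hP]] := set_0Vmem others; first by rewrite cards0.
apply: leq_trans (base3_class (zpar P) s3).
apply: subset_leq_card; apply/subsetP => Q hQ; rewrite inE hQ /=.
have d11 : (d <= 11)%N by lia.
have [x [y [_ [_ _ _ u]]]] := base3_sides s3 hP.
have [x' [y' [_ [_ _ _ u']]]] := base3_sides s3 hQ.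
by have [->//|[[h1 h2]|[h1 h2]]] := base3_zpar s3 d11 hQ hP; exfalso; lia.
Qed.

(** Besides A and B there are at most two points on the bisector; all others share one z, since z <=
    11. *)
Lemma base4_card : D A B = 4 -> (d <= 14)%N -> (n <= 6)%N.
Proof.
move=> s4 d14; apply: (@others_cover 4).
pose Z := [set P | [&& P != A, P != B & gap D A B P == 0%N]].
pose S := [set P in others | gap D A B P != 0%N].
apply: leq_trans (_ : #|Z :|: S| <= _)%N.
  apply: subset_leq_card; apply/subsetP => Q; rewrite !inE => /andP[-> ->] /=.
  exact: orbN.
rewrite (leq_trans (leq_card_setU _ _)) // (@leq_add _ _ 2 2) //.
  by apply: leq_trans (gap0_card p_inj hD hcross heven AB) _; rewrite s4.
have [->|[P]] := set_0Vmem S; first by rewrite cards0.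
rewrite inE => /andP[hP gP].
apply: leq_trans (base4_class (zpar P) s4).
apply: subset_leq_card; apply/subsetP => Q hSQ; rewrite inE hSQ /=.
move: hSQ; rewrite inE => /andP[hQ gQ].
have [x [y [[x0 y0 xy sxy] [e1 e2 l1 u1]]]] := base4_sides s4 hP gP.
have [x' [y' [[x0' y0' xy' sxy'] [e1' e2' l1' u1']]]] := base4_sides s4 hQ gQ.
have [k hk] := sides_square_pair AB x0 y0 sxy e1 e2 sxy' e1' e2' (etrans xy (esym xy')).
apply/eqP/esym; apply: square_pair4; [lia|lia|].
by apply: (square_pairP (k := k)); rewrite hk s4.
Qed.

End Base.
End SmallBase.

(** * Strips *)

Section Strips.
Variables (R : realFieldType) (n : nat).
Variables (p : 'I_n -> R * R) (D : 'I_n -> 'I_n -> nat).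
Hypothesis hD : forall i j, (D i j)%:R ^+ 2 = sqdist (p i) (p j).
Hypothesis hcross : forall i j k, i != j -> i != k -> j != k ->
  cross (p i) (p j) (p k) != 0.
Hypothesis heven : forall i j k, i != j -> i != k -> j != k ->
  ~~ odd (D i j + D i k + D j k).
Hypothesis hsort : forall i j : 'I_n, (i <= j)%N -> (p i).1 <= (p j).1.

(* Of the strips spanned by consecutive triples 2k, 2k+1, 2k+2 at most one
   contains both A and B. *)
Lemma strips (A B : 'I_n) (s t d m : nat) (w1 w2 : R) : A != B ->
  (forall i j, D i j <= d)%N -> (forall i j, i != j -> s <= D i j)%N ->
  (forall i j, i != j -> ~ (i = A /\ j = B) -> ~ (i = B /\ j = A) -> t <= D i j)%N ->
  0 <= w1 -> w1 <= w2 -> w1 ^+ 2 = 2 * s%:R - 1 -> w2 ^+ 2 = 2 * t%:R - 1 ->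
  (m.*2 < n)%N -> (0 < m)%N ->
  (m.-1)%:R * w2 + w1 <= d%:R.
Proof.
move=> AB hd hs ht w10 w12 ew1 ew2 mn m0.
have w20 : 0 <= w2 by exact: le_trans w12.
(* The default A occurs only for k >= n; the indices used are at most 2m < n. *)
pose q k : 'I_n := insubd A k.
have vq k : (k < n)%N -> val (q k) = k by move=> h; rewrite /q val_insubd h.
pose bad k := [&& k.*2 <= A, A <= k.*2.+2, k.*2 <= B & B <= k.*2.+2]%N.
pose g k := if bad k then w1 else w2.
have step k : (k < m)%N -> g k <= (p (q k.*2.+2)).1 - (p (q k.*2)).1.
  move=> km.
  have v0 : val (q k.*2) = k.*2 by apply: vq; lia.
  have v1 : val (q k.*2.+1) = k.*2.+1 by apply: vq; lia.
  have v2 : val (q k.*2.+2) = k.*2.+2 by apply: vq; lia.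
  have r0 : (k.*2 <= val (q k.*2) <= k.*2.+2)%N by rewrite v0; clear; lia.
  have r1 : (k.*2 <= val (q k.*2.+1) <= k.*2.+2)%N by rewrite v1; clear; lia.
  have r2 : (k.*2 <= val (q k.*2.+2) <= k.*2.+2)%N by rewrite v2; clear; lia.
  have n01 : q k.*2 != q k.*2.+1 by rewrite -val_eqE /= v0 v1; lia.
  have n02 : q k.*2 != q k.*2.+2 by rewrite -val_eqE /= v0 v2; lia.
  have n12 : q k.*2.+1 != q k.*2.+2 by rewrite -val_eqE /= v1 v2; lia.
  have s01 : (p (q k.*2)).1 <= (p (q k.*2.+1)).1.
    by apply: hsort; rewrite [X in (X <= _)%N]v0 [X in (_ <= X)%N]v1 leqnSn.
  have s12 : (p (q k.*2.+1)).1 <= (p (q k.*2.+2)).1.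
    by apply: hsort; rewrite [X in (X <= _)%N]v1 [X in (_ <= X)%N]v2 leqnSn.
  have dif0 : 0 <= (p (q k.*2.+2)).1 - (p (q k.*2)).1.
    by rewrite subr_ge0; exact: le_trans s12.
  rewrite /g; case: ifP => hb.
    rewrite -(ler_sqr (x := w1)) ?nnegrE // ew1.
    by apply: (strip_width hD hcross heven n01 n02 n12 s01 s12); exact: hs.
  rewrite -(ler_sqr (x := w2)) ?nnegrE // ew2.
  have far i j : (k.*2 <= val i <= k.*2.+2)%N -> (k.*2 <= val j <= k.*2.+2)%N ->
    i != j -> (t <= D i j)%N.
    move=> /andP[hi1 hi2] /andP[hj1 hj2] ij.
    apply: ht => // -[ei ej]; case/negP: (negbT hb);
      by rewrite /bad -ei -ej; apply/and4P; split.
  by apply: (strip_width hD hcross heven n01 n02 n12 s01 s12); apply: far.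
have tele j : (j <= m)%N -> \sum_(k < j) g k <= (p (q j.*2)).1 - (p (q 0)).1.
  elim: j => [|j IH] jm; first by rewrite big_ord0 subrr.
  rewrite big_ord_recr /= doubleS; have := IH (ltnW jm); have := step j jm; lra.
have hwid : (p (q m.*2)).1 - (p (q 0)).1 <= d%:R.
  apply: le_trans (ler_norm _) _; apply: norm_le_sqr => //.
  apply: le_trans (_ : sqdist (p (q m.*2)) (p (q 0)) <= _); first by rewrite lerDl sqr_ge0.
  by rewrite -hD lerXn2r ?nnegrE ?ler0n // ler_nat.
apply: le_trans hwid; apply: le_trans (tele m (leqnn m)).
have [/existsP[k0 hk0]|] := boolP [exists k : 'I_m, bad k].
  rewrite (bigD1 k0) //= {1}/g hk0 [X in X <= _]addrC lerD2l.
  rewrite (eq_bigr (fun=> w2)) => [|k kk0].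
    by rewrite sumr_const cardC1 card_ord mulr_natl.
  rewrite /g ifN //; apply: contraNN kk0 => hk.
  move: hk0 hk; rewrite /bad => /and4P[a1 a2 a3 a4] /and4P[b1 b2 b3 b4].
  have AB' : (A : nat) <> B by move/val_inj/eqP; exact/negP.
  apply/eqP/val_inj; move: AB' a1 a2 a3 a4 b1 b2 b3 b4; rewrite /=.
  by move: (nat_of_ord A) (nat_of_ord B) (nat_of_ord k) (nat_of_ord k0); clear; lia.
rewrite negb_exists => /forallP hk.
(* If no strip contains both, all m widths are at least w2 >= w1. *)
rewrite (eq_bigr (fun=> w2)) => [|k _]; last by rewrite /g ifN.
by rewrite sumr_const card_ord -[X in _ <= _ *+ X](prednK m0) mulr_natl mulrSr lerD2l.
Qed.
End Strips.

(** * Numerical estimates *)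

Section LargeBound.
Variable R : realFieldType.
Implicit Types N v w d : R.

(** N stands for n - 4, and 81/500 is slightly above (25/36)^5. *)
Lemma quintic_bound N : 17 <= N ->
  81 / 500 * (N + 4) ^+ 5 <=
  N ^+ 2 * (N ^+ 2 * (4 * N + 21) / 16 + 407 / 10 * N + 54).
Proof.
move=> hN; have N0 : 0 <= N by apply: le_trans hN.
have q1 : 0 <= N ^+ 3 * (88 / 1000 * N ^+ 2 - 193 / 100 * N + 1058 / 100).
  rewrite mulr_ge0 ?exprn_ge0 //.
  have : 0 <= 88 / 1000 * (N - 11) ^+ 2 by rewrite mulr_ge0 ?sqr_ge0 ?divr_ge0.
  lra.
have q2 : 0 <= N ^+ 2 * (N - 17) by rewrite mulr_ge0 ?sqr_ge0 ?subr_ge0.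
have q3 : 0 <= N * (N - 17) by rewrite mulr_ge0 ?subr_ge0.
have q4 : 0 <= N ^+ 4 by rewrite exprn_ge0.
lra.
Qed.

(** From N <= v^2 and v >= 5, (2v+1)^2 >= 4N + 21. Moreover 407/10 = 11 * 37/10 with 2v+1 >= 11, and
    54 is below 7.4^2. *)
Lemma quintic_bound_sqrt N v : 17 <= N -> 5 <= v -> N <= v ^+ 2 ->
  N ^+ 2 * (N ^+ 2 * (4 * N + 21) / 16 + 407 / 10 * N + 54) <=
  (N ^+ 2 * (2 * v + 1) / 4 + 74 / 10 * N) ^+ 2.
Proof.
move=> hN hv hNv; have N0 : 0 <= N by apply: le_trans hN.
have -> : (N ^+ 2 * (2 * v + 1) / 4 + 74 / 10 * N) ^+ 2 =
  N ^+ 2 * (N ^+ 2 * (2 * v + 1) ^+ 2 / 16 + 37 / 10 * (2 * v + 1) * N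
            + 5476 / 100) by field.
apply: ler_wpM2l; first exact: sqr_ge0.
have h1 : 4 * N + 21 <= (2 * v + 1) ^+ 2 by lra.
have h2 : 0 <= N ^+ 2 * ((2 * v + 1) ^+ 2 - (4 * N + 21)).
  by rewrite mulr_ge0 ?sqr_ge0 ?subr_ge0.
have h3 : 0 <= (v - 5) * N by rewrite mulr_ge0 ?subr_ge0.
lra.
Qed.

(** Used with N = n - 4, v = t - 1, w = sqrt(2t-1). The decimals 2.236 and 3.316 lie just below sqrt
    5 and sqrt 11, the widths for s = 3 and t = 6; 7.4 is below their product. *)
Lemma large_bound N v w d :
  17 <= N -> 5 <= v -> N <= v ^+ 2 -> 0 <= w -> w ^+ 2 = 2 * v + 1 ->
  N / 2 * w + 2236 / 1000 <= d -> (25 * (N + 4) / 36) ^+ 5 <= d ^+ 4.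
Proof.
move=> hN hv hNv w0 hw hd.
have N0 : 0 <= N by apply: le_trans hN.
have w3 : 3316 / 1000 <= w.
  have c0 : 0 <= 3316 / 1000 :> R by rewrite divr_ge0.
  rewrite -(ler_sqr c0) ?nnegrE // hw.
  by move: hv; clear; lra.
have h1 : 0 <= (w - 3316 / 1000) * N by rewrite mulr_ge0 ?subr_ge0.
have h0 : 0 <= N / 2 * w by rewrite !mulr_ge0 ?invr_ge0.
have d2 : N ^+ 2 * (2 * v + 1) / 4 + 74 / 10 * N <= d ^+ 2.
  apply: le_trans (_ : (N / 2 * w + 2236 / 1000) ^+ 2 <= _).
    have -> : (N / 2 * w + 2236 / 1000) ^+ 2 =
      N ^+ 2 * w ^+ 2 / 4 + 2236 / 1000 * (w * N) + (2236 / 1000) ^+ 2 by field.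
    by rewrite hw; move: h1 N0; clear; lra.
  have h : 0 <= N / 2 * w + 2236 / 1000 by rewrite addr_ge0 ?divr_ge0.
  by rewrite lerXn2r ?nnegrE ?(le_trans h).
have v0 : 0 <= v by apply: le_trans hv.
have h2 : 0 <= N ^+ 2 * (2 * v + 1) / 4 + 74 / 10 * N.
  by rewrite addr_ge0 ?divr_ge0 ?mulr_ge0 ?sqr_ge0 ?addr_ge0 ?mulr_ge0 ?invr_ge0.
have d4 : (N ^+ 2 * (2 * v + 1) / 4 + 74 / 10 * N) ^+ 2 <= d ^+ 4.
  have -> : d ^+ 4 = (d ^+ 2) ^+ 2 by rewrite -exprM.
  by rewrite lerXn2r ?nnegrE ?sqr_ge0.
apply: le_trans d4; apply: le_trans (quintic_bound_sqrt hN hv hNv).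
apply: le_trans (quintic_bound hN).
have -> : (25 * (N + 4) / 36) ^+ 5 = (25 / 36) ^+ 5 * (N + 4) ^+ 5 by rewrite mulrAC exprMn.
by apply: ler_wpM2r; [rewrite exprn_ge0 ?addr_ge0 | lra].
Qed.
End LargeBound.

(** * The diameter bound *)

(** The factor 3 is the strip width sqrt(2t-1) at t = 5. *)
Lemma small_table (R : realFieldType) (n d : nat) : (7 <= n <= 20)%N ->
  (3 * (n.-1)./2 <= d)%N -> (25 * n%:R / 36) ^+ 5 <= d%:R ^+ 4 :> R.
Proof.
move=> hn hd; apply: le_trans (_ : (3 * (n.-1)./2)%:R ^+ 4 <= _); last first.
  by rewrite lerXn2r ?nnegrE ?ler0n // ler_nat.
clear hd; do 21 (case: n hn => [|n] hn; first by [] || (by rewrite /=; lra)).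
by [].
Qed.

(** Put s-1 = 2a + e and t-1 = 2b + f with e, f in {0, 1}. As a, b >= 1, 4ab + 2e + 2f <= (s-1)(t-1)
    <= (t-1)^2. Small t is a finite check. *)
Lemma two_hyperbolas_numeric n s t : (3 <= s)%N -> (s <= t)%N ->
  (n <= 4 + 2 * ~~ odd s + 2 * ~~ odd t + 4 * (s.-1./2 * t.-1./2))%N ->
  [/\ (n <= 4 + t.-1 ^ 2)%N, (t <= 4)%N -> (n <= 12)%N,
      (t <= 4)%N -> s = 3 -> (n <= 10)%N & (t <= 5)%N -> (n <= 20)%N].
Proof.
move=> s3 st hn.
have small : (t <= 5)%N ->
    [|| (n <= 10)%N, (n <= 12)%N && (s == 4) | (5 <= t)%N && (n <= 20)%N].
  move=> t5; have es : s = 3 \/ s = 4 \/ s = 5 by lia.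
  have et : t = 3 \/ t = 4 \/ t = 5 by lia.
  by case: es st hn => [|[]] -> st; case: et st => [|[]] -> // _ /=; lia.
split; try (by lia).
have [a ha] : exists a, [/\ (0 < a)%N, s.-1./2 = a & s.-1 = (2 * a + ~~ odd s)%N].
  by exists (s.-1./2); split; lia.
have [b hb] : exists a, [/\ (0 < a)%N, t.-1./2 = a & t.-1 = (2 * a + ~~ odd t)%N].
  by exists (t.-1./2); split; lia.
move: ha hb hn => [a0 -> ea] [b0 -> eb] hn.
apply: leq_trans (_ : 4 + s.-1 * t.-1 <= _)%N; last first.
  by rewrite leq_add2l -mulnn leq_mul2r; lia.
rewrite ea eb; move: hn; case: (~~ odd s); case: (~~ odd t); nia.
Qed.

Lemma double_pred_ge0 (R : numDomainType) (k : nat) : (2 <= k)%N -> 0 <= 2 * k%:R - 1 :> R.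
Proof. by move=> hk; rewrite subr_ge0 -natrM ler1n; lia. Qed.

Lemma le_sqrt_double_pred (R : rcfType) (k l : nat) (c : R) : (l <= k)%N -> 0 <= c ->
  c ^+ 2 <= 2 * l%:R - 1 -> c <= Num.sqrt (2 * k%:R - 1).
Proof.
move=> lk c0 hc; rewrite -[c]ger0_norm // -sqrtr_sqr; apply: ler_wsqrtr.
by apply: le_trans hc _; rewrite lerD2r ler_pM2l // ler_nat.
Qed.

Lemma numeric_bound (R : rcfType) (n s t d : nat) :
  (3 <= n)%N -> (2 <= s)%N -> (s <= t)%N -> (s <= d)%N -> (3 <= d)%N ->
  (n <= 4 + 2 * ~~ odd s + 2 * ~~ odd t + 4 * (s.-1./2 * t.-1./2))%N ->
  (n.-1./2).-1%:R * Num.sqrt (2 * t%:R - 1) + Num.sqrt (2 * s%:R - 1) <= d%:R :> R ->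
  (s = 2 -> n <= 4)%N -> (s = 2 -> n = 4 -> 4 <= d)%N ->
  (s = 3 -> 4 <= d)%N -> (s = 3 -> d <= 6 -> n <= 4)%N ->
  (s = 3 -> d <= 11 -> n <= 6)%N -> (s = 4 -> d <= 14 -> n <= 6)%N ->
  (25 * n%:R / 36) ^+ 5 <= d%:R ^+ 4 :> R.
Proof.
move=> n3 s2 st sd d3 hcard; set m := n.-1./2.
set w2 := Num.sqrt (2 * t%:R - 1); set w1 := Num.sqrt (2 * s%:R - 1).
move=> hw c2 c2' d4 c36 c3 c4.
have table (k l : nat) : n = k -> (l <= d)%N ->
    (25 * k%:R / 36) ^+ 5 <= l%:R ^+ 4 :> R ->
    (25 * n%:R / 36) ^+ 5 <= d%:R ^+ 4 :> R.
  move=> -> ld h; apply: le_trans h _.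
  by rewrite lerXn2r ?nnegrE ?ler0n // ler_nat.
have low2 l (c : R) : (l <= t)%N -> 0 <= c -> c ^+ 2 <= 2 * l%:R - 1 -> c <= w2.
  exact: le_sqrt_double_pred.
have low1 l (c : R) : (l <= s)%N -> 0 <= c -> c ^+ 2 <= 2 * l%:R - 1 -> c <= w1.
  exact: le_sqrt_double_pred.
have [n7|n7] := ltnP n 7.
  have [e|[e|[e|e]]] : n = 3 \/ n = 4 \/ n = 5 \/ n = 6 by clear -n3 n7; lia.
  - by apply: (table 3 3) => //; clear; lra.
  - apply: (table 4 4) => //; last by clear; lra.
    by clear -e s2 sd c2' d4; lia.
  (* Two widths of at least 2.2 give d > 4. *)
  - have s3 : (3 <= s)%N by clear -e s2 c2; lia.
    have a1 := low1 3 (22 / 10) s3; have a2 := low2 3 (22 / 10) (leq_trans s3 st).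
    rewrite /m e mul1r in hw.
    apply: (table 5 5) => //; last by clear; lra.
    rewrite -(ltr_nat R); apply: lt_le_trans hw.
    have {}a1 : 22 / 10 <= w1 by apply: a1; clear; lra.
    have {}a2 : 22 / 10 <= w2 by apply: a2; clear; lra.
    by clear -a1 a2; lra.
  - apply: (table 6 6) => //; last by clear; lra.
    (* For s >= 4 two widths of at least 2.6 give d > 5; for s = 3, [c36] gives d >= 7. *)
    have [s4|s4] := leqP 4 s; last by clear -e s2 c2 s4 c36; lia.
    have a1 := low1 4 (26 / 10) s4; have a2 := low2 4 (26 / 10) (leq_trans s4 st).
    rewrite /m e mul1r in hw.
    rewrite -(ltr_nat R); apply: lt_le_trans hw.
    have {}a1 : 26 / 10 <= w1 by apply: a1; clear; lra.
    have {}a2 : 26 / 10 <= w2 by apply: a2; clear; lra.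
    by clear -a1 a2; lra.
have s3 : (3 <= s)%N by clear -n7 s2 c2; lia.
have [q1 q2 q3 q4] := two_hyperbolas_numeric s3 st hcard.
have m0 : (0 < m)%N by rewrite /m; clear -n7; lia.
have b1 : 2236 / 1000 <= w1.
  by apply: (low1 3) => //; clear; lra.
have b2 : (5 <= t)%N -> 3 <= w2.
  by move=> t5; apply: (low2 5) => //; clear; lra.
have [n20|n20] := leqP n 20.
  apply: small_table; first by rewrite n7.
  (* For t <= 4, either s = 3, n <= 10 and d >= 12, or s = 4, n <= 12 and d >= 15. *)
  have [t5|t5] := leqP 5 t; last first.
    by clear -n7 s3 st t5 q2 q3 c3 c4; lia.
  (* The strips give d > 3(m-1) + 2, hence d >= 3m by integrality. *)
  rewrite -/m; have -> : (3 * m = (3 * m.-1 + 2).+1)%N by clear -m0; lia.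
  rewrite -(ltr_nat R); apply: lt_le_trans hw.
  have h : m.-1%:R * 3 <= m.-1%:R * w2 by apply: ler_wpM2l => //; exact: b2.
  by rewrite natrD natrM; move: h b1; clear; lra.
have t6 : (6 <= t)%N by clear -n20 q4; lia.
have eN : n%:R = (n - 4)%:R + 4 :> R by rewrite -natrD subnK //; clear -n20; lia.
rewrite eN; apply: (@large_bound R (n - 4)%:R t.-1%:R w2 d%:R).
- by rewrite ler_nat; clear -n20; lia.
- by rewrite ler_nat; clear -t6; lia.
- by rewrite -natrX ler_nat; clear -q1; lia.
- exact: sqrtr_ge0.
- have -> : 2 * t.-1%:R + 1 = 2 * t%:R - 1 :> R.
    by rewrite -[in RHS](prednK (leq_trans (isT : (0 < 6)%N) t6)) -natr1; ring.
  by rewrite sqr_sqrtr // double_pred_ge0 // (leq_trans _ t6).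
apply: le_trans hw; apply: lerD => //; apply: ler_wpM2r; first exact: sqrtr_ge0.
rewrite ler_pdivrMr // -natrM ler_nat /m; clear -n20; lia.
Qed.

Section ConfigurationBound.
Variables (R : rcfType) (n : nat).
Variables (p : 'I_n -> R * R) (D : 'I_n -> 'I_n -> nat).
Hypothesis p_inj : injective p.
Hypothesis hD : forall i j, (D i j)%:R ^+ 2 = sqdist (p i) (p j).
Hypothesis hcross : forall i j k, i != j -> i != k -> j != k ->
  cross (p i) (p j) (p k) != 0.
Hypothesis heven : forall i j k, i != j -> i != k -> j != k ->
  ~~ odd (D i j + D i k + D j k).
Hypothesis h222 : forall i j k, i != j -> i != k -> j != k ->
  ~ [/\ D i j = 2, D i k = 2 & D j k = 2].
Hypothesis hsort : forall i j : 'I_n, (i <= j)%N -> (p i).1 <= (p j).1.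

Lemma third_point (A B : 'I_n) : (3 <= n)%N -> exists C, C != A /\ C != B.
Proof.
move=> n3; have [C /andP[CA CB]|h] := pickP (fun C => (C != A) && (C != B)).
  by exists C.
suff : (n <= 0 + 2)%N by lia.
apply: (@card_cover n A B set0) => [P PA PB|]; last by rewrite cards0.
by have := h P; rewrite PA PB.
Qed.

(** A, B attain the shortest distance s, and C, E the shortest distance t among the other pairs. *)
Lemma configuration_bound (d : nat) : (3 <= n)%N -> (forall i j, D i j <= d)%N ->
  (25 * n%:R / 36) ^+ 5 <= d%:R ^+ 4 :> R.
Proof.
move=> n3 hd.
have [A0 [B0 A0B0]] : exists A B : 'I_n, A != B.
  by exists (Ordinal (ltnW (ltnW n3))), (Ordinal (ltnW n3)).
pose pairs := [pred x : 'I_n * 'I_n | x.1 != x.2].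
have [A [B [AB hmin]]] : exists A B, A != B /\ forall i j, i != j -> (D A B <= D i j)%N.
  have [[A B] /= AB h] := @arg_minnP _ (A0, B0) pairs (fun x => D x.1 x.2) A0B0.
  by exists A, B; split=> // i j ij; apply: (h (i, j)).
have [C0 [C0A C0B]] := third_point A B n3.
pose pairs' := [pred x : 'I_n * 'I_n | [&& x.1 != x.2, x != (A, B) & x != (B, A)]].
have hAC0 : pairs' (A, C0).
  by rewrite /= eq_sym C0A !xpair_eqE eqxx /= C0B (negbTE C0A) andbF.
have [C [E [CE [nAC nAE hmin2]]]] : exists C E, C != E /\
    [/\ ~ (A = C /\ B = E), ~ (A = E /\ B = C) &
    forall i j, i != j -> ~ (i = A /\ j = B) -> ~ (i = B /\ j = A) -> (D C E <= D i j)%N].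
  have [[C E] /= /and3P[CE h1 h2] h] := @arg_minnP _ (A, C0) pairs' (fun x => D x.1 x.2) hAC0.
  exists C, E; split=> //; split.
  - by case=> ? ?; case/eqP: h1; congr pair.
  - by case=> ? ?; case/eqP: h2; congr pair.
  move=> i j ij n1 n2; apply: (h (i, j)); rewrite /= ij /=; apply/andP; split.
    by apply/eqP => -[? ?]; apply: n1.
  by apply/eqP => -[? ?]; apply: n2.
have st : (D A B <= D C E)%N by apply: hmin.
have hcard := card_two_hyperbolas p_inj hD hcross heven AB CE nAC nAE.
have [x [y [z [[x0 y0 z0] [h1 h2 h3]]]]] := ravi_base hD hcross heven AB C0A C0B.
have s2 : (2 <= D A B)%N by lia.
have nA0 : A != C0 by rewrite eq_sym.
have nB0 : B != C0 by rewrite eq_sym.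
have d3 : (3 <= d)%N.
  rewrite ltnNge; apply/negP => d2.
  have two i j : i != j -> D i j = 2.
    by move=> ij; apply/eqP; rewrite eqn_leq (leq_trans (hd _ _) d2) (leq_trans s2) ?hmin.
  by apply: (h222 AB nA0 nB0); rewrite !two.
have sd : (D A B <= d)%N by apply: hd.
have d4 : D A B = 3 -> (4 <= d)%N.
  move: (hmin _ _ nA0) (hmin _ _ nB0) (hd A C0) (hd B C0).
  by clear -h1 h2 h3 x0 y0; lia.
have c2 := base2_card p_inj hD hcross heven AB.
have c2' := base2_diam p_inj hD hcross heven h222 AB hd.
have c3 := base3_card p_inj hD hcross heven AB hmin hd.
have c36 := base3_card6 p_inj hD hcross heven AB hmin hd.
have c4 := base4_card p_inj hD hcross heven AB hmin hd.
apply: (@numeric_bound R n (D A B) (D C E) d) => //.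
apply: (strips hD hcross heven hsort AB hd hmin hmin2).
- exact: sqrtr_ge0.
- by apply: ler_wsqrtr; rewrite lerD2r ler_pM2l // ler_nat.
- by rewrite sqr_sqrtr // double_pred_ge0.
- by rewrite sqr_sqrtr // double_pred_ge0 // (leq_trans s2).
- by clear -n3; lia.
- by clear -n3; lia.
Qed.

End ConfigurationBound.

(** * The characteristic *)

Lemma rat_sqr_int (r : rat) (K : int) : r ^+ 2 = K%:~R -> exists k : int, K = k * k.
Proof.
move=> h; have hnd : numq r ^+ 2 = K * denq r ^+ 2.
  apply: (@intr_inj rat); by rewrite !expr2 !intrM !numqE -h; ring.
have : (`|denq r| ^ 2 %| `|numq r| ^ 2)%N by rewrite -!abszX hnd abszM dvdn_mull.
rewrite dvdn_pexp2r // => hdvd.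
have := coprime_num_den r; rewrite /coprime (gcdn_idPr hdvd) => /eqP d1.
exists (numq r); move: hnd; rewrite -(absz_denq r) d1 expr1n mulr1 => <-.
by rewrite expr2.
Qed.

(** The products are 3 and 2 modulo 4. *)
Lemma sqr_mod4 (u v k : int) :
  (4 * u + 3) * (4 * v + 1) != k * k /\ (4 * u + 3) * (4 * v + 2) != k * k.
Proof.
have [e [ek|ek]] : exists e, k = 2 * e \/ k = 2 * e + 1 by exists (divz k 2); lia.
  by split; apply/eqP; rewrite ek => h; lia.
by split; apply/eqP; rewrite ek => h; lia.
Qed.

(** The product is 4a^2b^2 - (a^2+b^2-c^2)^2, and a^2+b^2-c^2 is odd like the perimeter. *)
Lemma heron_int_mod4 (a b c : nat) : odd (a + b + c) -> exists u : int,
  ((a%:Z + b%:Z + c%:Z) * (b%:Z + c%:Z - a%:Z) * (a%:Z + c%:Z - b%:Z)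
    * (a%:Z + b%:Z - c%:Z)) = 4 * u + 3.
Proof.
move=> ho.
have par (x : nat) : exists t : int, x%:Z * x%:Z = 2 * t + x%:Z.
  elim: x => [|x [t ht]]; first by exists 0.
  by exists (t + x%:Z); rewrite -addn1 PoszD; lia.
have [[ta ha] [tb hb] [tc hc]] := And3 (par a) (par b) (par c).
have [f hf] : exists f : int, a%:Z * a%:Z + b%:Z * b%:Z - c%:Z * c%:Z = 2 * f + 1.
  exists (ta + tb - tc + (a + b + c)./2%:Z - c%:Z); rewrite ha hb hc.
  by move: ho; clear; lia.
exists (a%:Z * a%:Z * (b%:Z * b%:Z) - f * f - f - 1).
transitivity (4 * (a%:Z * a%:Z * (b%:Z * b%:Z)) -
  (a%:Z * a%:Z + b%:Z * b%:Z - c%:Z * c%:Z) * (a%:Z * a%:Z + b%:Z * b%:Z - c%:Z * c%:Z)).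
  by ring.
by rewrite hf; ring.
Qed.

Section Bridge.
Variable R : realType.
Implicit Types (P Q S : R * R) (M : {fset R * R}).

Lemma cross0_collinear P Q S : P != Q -> cross P Q S = 0 -> collinear [fset P; Q; S]%fset.
Proof.
move=> PQ h; exists (P.2 - Q.2), (Q.1 - P.1), ((P.2 - Q.2) * P.1 + (Q.1 - P.1) * P.2).
split.
  apply/orP; rewrite !subr_eq0 -negb_and; apply: contraNN PQ => /andP[/eqP h2 /eqP h1].
  by apply/eqP; rewrite [LHS]surjective_pairing h2 -h1 -surjective_pairing.
move=> T; rewrite !inE => /orP[/orP[]|] /eqP -> //; first by ring.
by move: h; rewrite /cross; lra.
Qed.

(** If the area is r sqrt q, then K = 16 r^2 q, so K q = (4qr)^2 is the square of a rational, hence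
    of an integer. *)
Lemma char_square M q P Q S (K : int) : is_char M q ->
  P \in M -> Q \in M -> S \in M -> ~ collinear [fset P; Q; S]%fset ->
  4 * cross P Q S ^+ 2 = K%:~R -> exists k : int, K * q%:Z = k * k.
Proof.
move=> [[q0 _] hq] PM QM SM hc hK.
have [r hr] := hq P Q S PM QM SM hc.
apply: (@rat_sqr_int (4 * q%:R * r)); apply: (fmorph_inj (@ratr R)).
have sq0 : Num.sqrt q%:R != 0 :> R by rewrite sqrtr_eq0 -ltNge ltr0n.
transitivity ((4 * q%:R * ratr r) ^+ 2 : R).
  by rewrite rmorphXn /= !rmorphM /= !ratr_nat.
rewrite /= ratr_int intrM -hK -hr.
rewrite /triangle_area -[_ - _]/(cross P Q S).
rewrite -[in RHS](real_normK (num_real (cross P Q S))).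
rewrite -[q%:~R]/(q%:R : R).
have hq2 : Num.sqrt q%:R ^+ 2 = q%:R :> R by rewrite sqr_sqrtr.
move: (Num.norm _) => c; move: sq0 hq2; move: (Num.sqrt _) => t t0 ht.
have -> : (4 * q%:R * (c / 2 / t)) ^+ 2 = 4 * c ^+ 2 * (q%:R ^+ 2 / t ^+ 2) by field.
by rewrite ht expr2 mulfK // pnatr_eq0 -lt0n.
Qed.

(** Dividing out l^2 would make (4u+3) q a square, but a squarefree q outside 4k+3 is 1 or 2 modulo
    4. The factor l = 1 serves odd perimeters, l = 4 the equilateral triangle of side 2. *)
Lemma char_not_mod4_3 M q P Q S (u : int) :
  is_char M q -> (~ exists k : nat, q = (4 * k + 3)%N) ->
  P \in M -> Q \in M -> S \in M -> ~ collinear [fset P; Q; S]%fset ->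
  forall l : int, l != 0 -> 4 * cross P Q S ^+ 2 <> (l ^+ 2 * (4 * u + 3))%:~R.
Proof.
move=> hq hq3 PM QM SM hc l l0 hK.
have [k hk] := char_square hq PM QM SM hc hK.
have [[q0 qsf] _] := hq.
have : (l %| k)%Z.
  rewrite dvdzE -(@dvdn_pexp2r _ _ 2) // -!abszX -dvdzE.
  have -> : k ^+ 2 = l ^+ 2 * ((4 * u + 3) * q%:Z) by rewrite mulrA hk expr2.
  exact: dvdz_mulr.
move=> /dvdzP[k' ek]; move: hk; rewrite ek => hk.
have {}hk : (4 * u + 3) * q%:Z = k' * k'.
  apply: (@mulfI _ (l ^+ 2)); first by rewrite expf_neq0.
  by rewrite mulrA hk expr2; ring.
have q4 : ~~ (4 %| q)%N by apply/negP => h4; have := qsf 2 h4.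
have q3 : (q %% 4 != 3)%N.
  by apply/eqP => h; apply: hq3; exists (q %/ 4)%N; rewrite {1}(divn_eq q 4) h mulnC.
have [v [e|e]] : exists v : int, q%:Z = 4 * v + 1 \/ q%:Z = 4 * v + 2.
  by exists (q %/ 4)%N%:Z; move: q4 q3; clear; lia.
- by have [/eqP + _] := sqr_mod4 u v k'; rewrite -e hk.
- by have [_ /eqP +] := sqr_mod4 u v k'; rewrite -e hk.
Qed.
End Bridge.

(** * From the point set to an indexed configuration *)

Unset Implicit Arguments.

Theorem theorem6p2 (R : realType) (n : nat) (M : {fset R * R}) (q : nat)
    (hn : (3 <= n)%N)
    (hM : planar_integral_point_set M)
    (hcard : #|` M| = n)
    (hgen : semi_general_position M)
    (hq : is_char M q)
    (hq43 : ~ exists k : nat, q = (4 * k + 3)%N) :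
  (25 * n%:R / 36) `^ (5 / 4) <= diam M.
Proof.
(* The points are indexed by increasing abscissa, as the strips require. *)
pose leX (P Q : R * R) := P.1 <= Q.1.
pose pts := sort leX M.
have size_pts : size pts = n by rewrite size_sort.
have uniq_pts : uniq pts by rewrite sort_uniq fset_uniq.
have leX_tr : transitive leX by move=> x y z; exact: le_trans.
have leX_refl : reflexive leX by move=> x; exact: lexx.
have sorted_pts : sorted leX pts by apply: sort_sorted => x y; exact: le_total.
pose p (i : 'I_n) := nth (0, 0) pts i.
have pM i : p i \in M by rewrite -(mem_sort leX) mem_nth // size_pts.
have p_inj : injective p.
  by move=> i j /eqP; rewrite nth_uniq ?size_pts // => /eqP/val_inj.
(* Distances are nonnegative integers, so truncation is exact. *)
pose D (i j : 'I_n) := Num.truncn (edist (p i) (p j)).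
have eD i j : (D i j)%:R = edist (p i) (p j).
  by rewrite /D truncnK // natrEint hM.2 //= sqrtr_ge0.
have hD i j : (D i j)%:R ^+ 2 = sqdist (p i) (p j).
  by rewrite eD sqr_sqrtr // addr_ge0 ?sqr_ge0.
have ncol i j k : i != j -> i != k -> j != k -> ~ collinear [fset p i; p j; p k]%fset.
  by move=> ij ik jk; apply: hgen => //; rewrite (inj_eq p_inj).
have hcross i j k : i != j -> i != k -> j != k -> cross (p i) (p j) (p k) != 0.
  move=> ij ik jk; apply/eqP => h; apply: (ncol i j k) => //.
  by apply: cross0_collinear => //; rewrite (inj_eq p_inj).
have heven i j k : i != j -> i != k -> j != k -> ~~ odd (D i j + D i k + D j k).
  move=> ij ik jk; apply/negP => ho.
  have [|u hu] := @heron_int_mod4 (D j k) (D i k) (D i j).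
    by rewrite addnC addnA addnAC.
  apply: (@char_not_mod4_3 R M q (p i) (p j) (p k) u hq hq43 (pM i) (pM j) (pM k)
    (ncol i j k ij ik jk) 1 isT).
  rewrite (heron (hD j k) (hD i k) (hD i j)) expr1n mul1r -hu.
  by rewrite !(rmorphM, rmorphB, rmorphD) /=.
have h222 i j k : i != j -> i != k -> j != k ->
    ~ [/\ D i j = 2, D i k = 2 & D j k = 2].
  move=> ij ik jk [e1 e2 e3].
  (* Sides 2, 2, 2 give 4 cross^2 = 48 = 4^2 * 3. *)
  apply: (@char_not_mod4_3 R M q (p i) (p j) (p k) 0 hq hq43 (pM i) (pM j) (pM k)
    (ncol i j k ij ik jk) 4 isT).
  by rewrite (heron (hD j k) (hD i k) (hD i j)) e1 e2 e3; lra.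
have hsort (i j : 'I_n) : (i <= j)%N -> (p i).1 <= (p j).1.
  by move=> ij; apply: (sorted_leq_nth leX_tr leX_refl _ sorted_pts); rewrite // inE size_pts.
have diam_ge P Q : P \in M -> Q \in M -> edist P Q <= diam M.
  move=> PM QM; rewrite /diam.
  apply: (@bigmax_sup_seq _ R _ (enum_fset M) 0 P xpredT _ _ PM isT).
  exact: (@le_bigmax_seq _ R _ (enum_fset M) 0 Q xpredT (edist P) QM isT).
have diam0 : 0 <= diam M.
  by apply: le_trans (diam_ge _ _ (pM (Ordinal hn)) (pM (Ordinal hn))); exact: sqrtr_ge0.
pose d := Num.truncn (diam M).
have hd i j : (D i j <= d)%N by apply: le_truncn; exact: diam_ge.
have := @configuration_bound R n p D p_inj hD hcross heven h222 hsort d hn hd.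
have dle : d%:R <= diam M by rewrite truncn_le.
move=> hpow; apply: le_trans dle.
have x0 : 0 <= 25 * n%:R / 36 :> R by rewrite divr_ge0 ?mulr_ge0.
(* Fourth roots turn x^5 <= d^4 into x^(5/4) <= d. *)
have d14 : d%:R = (d%:R ^+ 4) `^ 4^-1 :> R.
  by rewrite -powR_mulrn // -powRrM mulfV ?powRr1 // pnatr_eq0.
rewrite powRrM powR_mulrn // d14.
by apply: ge0_ler_powR; rewrite ?nnegrE ?invr_ge0 ?exprn_ge0.
Qed.
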